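(* Let $d\ge 1$ and $L\ge 2$ be integers, let $\alpha\ge d$, and consider long-range percolation on the hierarchical lattice $\mathbb{H}^d_L$ in which each pair of distinct vertices $x,y$ is independently connected by an edge with probability $1-\exp(-\beta\|x-y\|^{-d-\alpha})$. Let $\chi(\beta)$ denote the expected number of vertices in the cluster of the origin. Then, as $\beta\to\infty$ (with $d,L,\alpha$ fixed), $$\chi(\beta)=\begin{cases} e^{e^{\Theta(\beta)}} & \text{if } \alpha=d,\\ \beta^{\frac{d}{\alpha-d}-o(1)} & \text{if }\alpha>d.\end{cases}$$ Explicitly: if $\alpha=d$, there exist constants $0<c\le C<\infty$ and $\beta_0<\infty$ (depending on $d,L$) such that $e^{e^{c\beta}}\le\chi(\beta)\le e^{e^{C\beta}}$ for every $\beta\ge\beta_0$; if $\alpha>d$, then $\lim_{\beta\to\infty}\frac{\log\chi(\beta)}{\log\beta}=\frac{d}{\alpha-d}$.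
   Context: The hierarchical lattice $\mathbb{H}^d_L$ is the group $\bigoplus_{i=1}^\infty(\mathbb{Z}/L\mathbb{Z})^d$ equipped with the ultrametric $\|x-y\|:=L^{\max\{i:\,x_i\ne y_i\}}$ for distinct $x,y$ (and $0$ if $x=y$). Its origin is the identity element $0$. For $\alpha>0$ and $\beta\ge0$, long-range percolation on $\mathbb{H}^d_L$ is the random graph $\omega$ with vertex set $\mathbb{H}^d_L$ in which each possible edge $\{x,y\}$ with $x\neq y$ is included independently with probability $1-\exp(-\beta\|x-y\|^{-d-\alpha})$; its law is $\mathbb{P}_\beta$, with expectation $\mathbb{E}_\beta$ ($\alpha$ is fixed and omitted from the notation). Connected components of $\omega$ are called clusters, $K_0$ is the cluster of the origin, and the susceptibility is $\chi(\beta):=\mathbb{E}_\beta|K_0|$. *)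

(* Defs.v *)
From HB Require Import structures.
From Stdlib Require Import Relation_Operators.
From mathcomp Require Import all_boot all_order all_algebra.
From mathcomp Require Import finmap.
From mathcomp Require Import monalg.
From mathcomp Require Import all_classical all_reals all_analysis.

Set Implicit Arguments.
Unset Strict Implicit.
Unset Printing Implicit Defensive.
Import Order.TTheory GRing.Theory Num.Theory.
Import numFieldNormedType.Exports.

Local Open Scope fset_scope.
Local Open Scope classical_set_scope.
Local Open Scope ring_scope.

(* The additive group of finitely supported functions nat -> (Z/LZ)^d; index i
   here is the coordinate i + 1 of the usual 1-based indexing.  ['Z_L] is the
   ring Z/LZ only when 1 < L. *)
Definition hlattice (d L : nat) : zmodType := {malg 'rV['Z_L]_d [nat]}.

(* [msupp (x - y)] is the finite set of coordinates where x and y differ. *)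
Definition hdist (d L : nat) (x y : hlattice d L) : nat :=
  if x == y then 0%N else (L ^ \max_(i <- msupp (x - y)) i.+1)%N.

Definition edge (d L : nat) : choiceType :=
  {e : {fset hlattice d L} | #|` e| == 2%N}.

(* A configuration is the set of its open edges. *)
Definition edge_open (d L : nat) (e : edge d L) : set (set (edge d L)) :=
  [set w | w e].

(* Configurations with the product sigma-algebra. *)
Definition config (d L : nat) :=
  g_sigma_algebraType (range (@edge_open d L)).

Definition open_adjacent (d L : nat) (w : config d L) (x y : hlattice d L) : Prop :=
  exists2 e : edge d L, edge_open e w & val e = [fset x; y].

Definition open_cluster (d L : nat) (w : config d L) (x : hlattice d L) :
    set (hlattice d L) :=
  [set y | clos_refl_trans _ (open_adjacent w) x y].

Definition independent_events (disp : measure_display)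
    (T : measurableType disp) (R : realType) (P : probability T R)
    (I : choiceType) (E : I -> set T) : Prop :=
  (forall i, measurable (E i)) /\
  (forall A : {fset I},
     P (\bigcap_(i in [set` A]) E i) = (\prod_(i <- A) P (E i))%E).

(* [P] is the law of long-range percolation; the pi-lambda theorem shows that
   these conditions determine [P]. *)
Definition percolation_law (R : realType) (d L : nat) (alpha beta : R)
    (P : probability (config d L) R) : Prop :=
  independent_events P (@edge_open d L) /\
  (forall (e : edge d L) (x y : hlattice d L), val e = [fset x; y] ->
     P (edge_open e) =
     (1 - expR (- (beta * (hdist x y)%:R `^ (- (d%:R + alpha)))))%:E).

Definition susceptibility (R : realType) (d L : nat)
    (P : probability (config d L) R) : \bar R :=
  (\int[P]_w counting (open_cluster w 0%R))%E.

(* Main.v *)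
(** Write [N = L ^ d], let [chi_n] be the expected size of the cluster of the
    origin using only edges of level at most [n], and let [h_n] be the expected
    number of open edges of level greater than [n] at a vertex.

    Upper bounds.  Cutting a path where it first leaves the low-level cluster of
    its starting point gives [chi <= chi_n + chi_n h_n chi], so that
    [chi <= 2 chi_n <= 2 N ^ n] as soon as [chi_n h_n <= 1/2].  If [alpha > d] the
    trivial bound [chi_n <= N ^ n] makes this true when
    [L ^ (n (alpha - d)) >= 2 beta].  If [alpha = d] we need some
    [n <= exp (C beta)] with [chi_n / N ^ n] of order at most [1 / beta].  A ball of
    level [m] has no open edge to its complement with probability at least
    [exp (- beta)], independently of its inside; if moreover its inside cluster of
    the origin reaches level [m], then [m] is the highest level reached.  Hence the
    probabilities [w_m] of reaching level [m] inside the [m]-ball sum to at most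
    [exp beta], and [chi_n <= sum_(m <= n) w_m N ^ m] yields
    [sum_n chi_n / N ^ n <= 2 exp beta].

    Lower bounds.  The largest clusters of the [N] children of a ball are all
    joined except with probability exponentially small in [beta] times their
    densities.  If [alpha > d], a union bound shows that a ball of volume
    [beta ^ (d / (alpha - d) - o(1))] is connected with probability at least [1/2].
    If [alpha = d], group the levels in blocks of [k = c beta] levels and tolerate
    one bad descendant out of [N ^ k] in each block: two bad ones are quadratically
    unlikely, so the probability of being bad does not accumulate, while a block
    costs only a factor [1 - N ^ - k] in density.  The density therefore stays
    above [1/2] for [N ^ (k - 1)] blocks. *)

Require Import Defs.
From HB Require Import structures.
From Stdlib Require Import Relation_Operators Operators_Properties.
From mathcomp Require Import all_boot all_order all_algebra.
From mathcomp Require Import finmap monalg ring lra.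
From mathcomp Require Import all_classical all_reals all_analysis measurable_realfun.

Import Order.TTheory GRing.Theory Num.Theory.
Import numFieldNormedType.Exports.

Set Implicit Arguments.
Unset Strict Implicit.
Unset Printing Implicit Defensive.

Local Open Scope ring_scope.

(** * Bernoulli measures on the subsets of a finite type *)

Lemma ler_bool (R : realType) (a b : bool) : (a -> b) -> a%:R <= b%:R :> R.
Proof. by case: a; case: b => // ab; have := ab isT. Qed.

Section Bernoulli.
Local Open Scope set_scope.
Local Open Scope ring_scope.
Variables (R : realType) (T : finType) (p : T -> R).
Hypothesis hp : forall t, 0 <= p t <= 1.
Implicit Types (S A B : {set T}) (f g : {set T} -> R) (Q : pred {set T}).

Definition wt S : R := \prod_t (if t \in S then p t else 1 - p t).
Definition Ex f : R := \sum_S wt S * f S.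
Definition Pr Q : R := Ex (fun S => (Q S)%:R).

Lemma wt_ge0 S : 0 <= wt S.
Proof.
apply: prodr_ge0 => t _; have /andP[h0 h1] := hp t.
by case: ifP; rewrite ?subr_ge0.
Qed.

Lemma eq_Ex f g : f =1 g -> Ex f = Ex g.
Proof. by move=> fg; apply: eq_bigr => S _; rewrite fg. Qed.

Lemma le_Ex f g : (forall S, f S <= g S) -> Ex f <= Ex g.
Proof. by move=> fg; apply: ler_sum => S _; rewrite ler_wpM2l ?wt_ge0. Qed.

Lemma ExD f g : Ex (fun S => f S + g S) = Ex f + Ex g.
Proof. by rewrite -big_split; apply: eq_bigr => S _; rewrite mulrDr. Qed.

Lemma ExZ c f : Ex (fun S => c * f S) = c * Ex f.
Proof. by rewrite mulr_sumr; apply: eq_bigr => S _; rewrite mulrCA. Qed.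

Lemma Ex_sum (I : finType) (P : pred I) (F : I -> {set T} -> R) :
  Ex (fun S => \sum_(i | P i) F i S) = \sum_(i | P i) Ex (F i).
Proof.
by rewrite exchange_big; apply: eq_bigr => S _; rewrite mulr_sumr.
Qed.

(** The weight is a product over coordinates. Total mass, avoidance and inclusion probabilities
    follow by writing the indicator as a product of this form. *)
Lemma Ex_prod (F G : T -> R) :
  Ex (fun S => \prod_t (if t \in S then F t else G t)) =
  \prod_t (p t * F t + (1 - p t) * G t).
Proof.
rewrite bigA_distr; apply: eq_bigr => S _; rewrite -big_split.
by apply: eq_bigr => t _ /=; case: ifP.
Qed.

Lemma Ex1 : Ex (fun=> 1) = 1.
Proof.
rewrite (eq_Ex (g := fun S => \prod_t (if t \in S then 1 else 1))); last first.
  by move=> S; rewrite big1// => t _; case: ifP.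
by rewrite Ex_prod big1 // => t _; rewrite !mulr1 addrC subrK.
Qed.

Lemma Ex_cst c : Ex (fun=> c) = c.
Proof. by rewrite -[RHS]mulr1 -Ex1 -ExZ; apply: eq_Ex => S; rewrite mulr1. Qed.

Lemma Ex_ge0 f : (forall S, 0 <= f S) -> 0 <= Ex f.
Proof. by move=> f0; rewrite -(Ex_cst 0); exact: le_Ex. Qed.

Lemma eq_Pr Q1 Q2 : Q1 =1 Q2 -> Pr Q1 = Pr Q2.
Proof. by move=> QQ; apply: eq_Ex => S; rewrite QQ. Qed.

Lemma le_Pr Q1 Q2 : (forall S, Q1 S -> Q2 S) -> Pr Q1 <= Pr Q2.
Proof.
by move=> QQ; apply: le_Ex => S; exact/ler_bool/QQ.
Qed.

Lemma Pr_ge0 Q : 0 <= Pr Q.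
Proof. by apply: Ex_ge0 => S; rewrite /= ler0n. Qed.

Lemma Pr_le1 Q : Pr Q <= 1.
Proof. by rewrite -Ex1; apply: le_Ex => S; case: (Q S). Qed.

Lemma PrC Q : Pr (fun S => ~~ Q S) = 1 - Pr Q.
Proof.
apply/eqP; rewrite eq_sym subr_eq -ExD -{1}Ex1; apply/eqP/eq_Ex => S.
by case: (Q S); rewrite /= ?add0r ?addr0.
Qed.

Lemma Pr_avoid A : Pr (fun S => [disjoint A & S]) = \prod_(t in A) (1 - p t).
Proof.
rewrite /Pr (eq_Ex (g := fun S => \prod_t (if t \in S then (t \notin A)%:R else 1))).
  rewrite Ex_prod [RHS]big_mkcond; apply: eq_bigr => t _.
  by case: (t \in A); rewrite /= ?mulr0 ?mulr1 ?add0r // addrC subrK.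
move=> S; case: (boolP [disjoint A & S]) => [dAS|].
  rewrite big1 // => t _; case: ifP => // tS.
  by have := disjointFl dAS tS => ->.
rewrite -finset.setI_eq0 => /finset.set0Pn[t /finset.setIP[tA tS]].
by rewrite (bigD1 t) //= tS tA mul0r.
Qed.

Lemma Pr_mem t : Pr (fun S => t \in S) = p t.
Proof.
have := Pr_avoid [set t]; rewrite big_set1.
rewrite (eq_Pr (Q2 := fun S => ~~ (t \in S))); last by move=> S; rewrite disjoints1.
by rewrite PrC => /addrI/oppr_inj.
Qed.

Definition mix A S S' := (S :&: A) :|: (S' :\: A).

Lemma mixA A S S' : mix A S S' :&: A = S :&: A.
Proof.
by apply/setP => t; rewrite !inE; case: (t \in A); rewrite ?andbF ?andbT ?orbF.
Qed.

Lemma mixD A S S' : mix A S S' :\: A = S' :\: A.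
Proof. by apply/setP => t; rewrite !inE; case: (t \in A); rewrite /= ?andbF. Qed.

(* Swapping the coordinates outside [A] is an involution of the pair [(S, S')]
   that preserves the product weight. *)
Lemma Ex_mix A f : Ex f = Ex (fun S => Ex (fun S' => f (mix A S S'))).
Proof.
pose sw (u : {set T} * {set T}) := (mix A u.1 u.2, mix A u.2 u.1).
have swK : involutive sw.
  case=> S S'; congr pair; apply/setP => t; rewrite !inE /=;
  by case: (t \in A); rewrite /= ?andbF ?andbT ?orbF.
have -> : Ex f = \sum_u wt u.1 * wt u.2 * f u.1.
  rewrite -(pair_bigA _ (fun S S' => wt S * wt S' * f S)) /=.
  apply: eq_bigr => S _; rewrite -mulr_suml -mulr_sumr.
  by have := Ex1; rewrite /Ex; under eq_bigr do rewrite mulr1; move=> ->; rewrite mulr1.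
rewrite (reindex_inj (inv_inj swK)) /=.
rewrite -(pair_bigA _ (fun S S' => wt (mix A S S') * wt (mix A S' S) * f (mix A S S'))).
apply: eq_bigr => S _ /=; rewrite mulr_sumr; apply: eq_bigr => S' _.
rewrite mulrA; congr (_ * _); rewrite -!big_split; apply: eq_bigr => t _ /=.
rewrite !inE; case: (t \in A) => /=; rewrite ?andbT ?andbF ?orbF //.
by rewrite mulrC.
Qed.

Definition depends (rT : Type) A (f : {set T} -> rT) := forall S, f S = f (S :&: A).

Lemma dependsW rT A B (f : {set T} -> rT) :
  A \subset B -> depends A f -> depends B f.
Proof. by move=> AB fA S; rewrite fA [RHS]fA -finset.setIA (finset.setIidPr AB). Qed.

(** After the coordinates outside [A] are resampled by [Ex_mix], [f] sees only the first sample and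
    [g] only the second, so the expectation factors. *)
Lemma Ex_indep A B f g : [disjoint A & B] -> depends A f -> depends B g ->
  Ex (fun S => f S * g S) = Ex f * Ex g.
Proof.
move=> AB fA gB; have gA S : g S = g (S :\: A).
  rewrite gB [RHS]gB; congr g; apply/setP => t; rewrite !inE.
  case: (boolP (t \in B)); rewrite ?andbF // => tB.
  by rewrite (disjointFl AB tB).
rewrite (Ex_mix A).
under eq_Ex => S.
  under eq_Ex => S' do rewrite fA gA mixA mixD -fA -gA.
  rewrite ExZ mulrC.
  over.
by rewrite ExZ mulrC.
Qed.

Lemma Pr_indep A B Q1 Q2 : [disjoint A & B] -> depends A Q1 -> depends B Q2 ->
  Pr (fun S => Q1 S && Q2 S) = Pr Q1 * Pr Q2.
Proof.
move=> AB QA QB; rewrite -(Ex_indep AB).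
- by apply: eq_Ex => S; rewrite -natrM mulnb.
- by move=> S; rewrite QA.
- by move=> S; rewrite QB.
Qed.

Lemma Ex_auto (s : T -> T) f : injective s -> (forall t, p (s t) = p t) ->
  Ex (fun S => f (s @: S)) = Ex f.
Proof.
move=> si ps; have sI : injective (fun S => s @: S) := imset_inj si.
rewrite [RHS](reindex_inj sI); apply: eq_bigr => S _; congr (_ * _).
rewrite [RHS](reindex_inj si); apply: eq_bigr => t _.
by rewrite mem_imset // ps.
Qed.

End Bernoulli.

(** * Clusters of a set of edges *)

Section Clusters.
Local Open Scope set_scope.
Local Open Scope ring_scope.
Variable V : finType.
Implicit Types (S U : {set {set V}}) (A B C D : {set V}).

Definition adj S : rel V := [rel x y | [set x; y] \in S].
Definition cl S x : {set V} := [set y | connect (adj S) x y].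
(* [set0] is excluded so that disjoint sets have disjoint [within]. *)
Definition within B : {set {set V}} :=
  [set e : {set V} | (e \subset B) && (e != finset.set0)].
Definition touching B : {set {set V}} := [set e : {set V} | ~~ [disjoint e & B]].

Lemma adj_sym S : symmetric (adj S).
Proof. by move=> x y; rewrite /adj /= finset.setUC. Qed.

Lemma connect_adjC S : connect_sym (adj S).
Proof. exact/sym_connect_sym/adj_sym. Qed.

Lemma mem_cl S x y : (y \in cl S x) = connect (adj S) x y.
Proof. by rewrite inE. Qed.

Lemma cl_refl S x : x \in cl S x.
Proof. by rewrite mem_cl connect0. Qed.

Lemma cl_adj S x y z : y \in cl S x -> adj S y z -> z \in cl S x.
Proof. by rewrite !mem_cl => xy yz; apply: connect_trans xy (connect1 yz). Qed.

Lemma cl_trans S x y : y \in cl S x -> cl S y = cl S x.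
Proof.
rewrite mem_cl => xy; apply/setP => z; rewrite !mem_cl.
by rewrite (same_connect (connect_adjC S) xy).
Qed.

Lemma cl_min S B x : x \in B ->
  (forall y z, y \in B -> adj S y z -> z \in B) -> cl S x \subset B.
Proof.
move=> xB BS; have cB : fingraph.closed (adj S) (mem B).
  by apply: (intro_closed (connect_adjC S)) => y z yz yB; exact: BS yB yz.
apply/fintype.subsetP => y; rewrite mem_cl => xy.
by rewrite -(closed_connect cB xy).
Qed.

Lemma cl_mono S U x : S \subset U -> cl S x \subset cl U x.
Proof.
move=> SU; apply: cl_min; first exact: cl_refl.
by move=> y z yC /(fintype.subsetP SU) yz; exact: cl_adj yC yz.
Qed.

Lemma mem_within B x y : ([set x; y] \in within B) = (x \in B) && (y \in B).
Proof.
rewrite inE finset.subUset !finset.sub1set.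
by rewrite (_ : _ != _) ?andbT //; apply/finset.set0Pn; exists x; rewrite !inE eqxx.
Qed.

Lemma mem_touching B x y : ([set x; y] \in touching B) = (x \in B) || (y \in B).
Proof.
rewrite inE -finset.setI_eq0; apply/finset.set0Pn/orP.
  by case=> z /finset.setIP[]; rewrite !inE => /orP[] /eqP -> ->; [left | right].
by case=> zB; [exists x | exists y]; rewrite !inE eqxx ?orbT.
Qed.

Lemma within_mono B C : B \subset C -> within B \subset within C.
Proof.
move=> BC; apply/fintype.subsetP => e; rewrite !inE => /andP[eB ->].
by rewrite (fintype.subset_trans eB BC).
Qed.

Lemma within_touching B : within B \subset touching B.
Proof.
apply/fintype.subsetP => e; rewrite !inE => /andP[eB /finset.set0Pn[x xe]].
rewrite -finset.setI_eq0; apply/finset.set0Pn; exists x.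
by rewrite inE xe (fintype.subsetP eB).
Qed.

Lemma within_disjoint B C : [disjoint B & C] -> [disjoint within B & within C].
Proof.
move=> BC; apply/pred0P => e; rewrite /= !inE; apply/negP.
move=> /andP[/andP[eB /finset.set0Pn[x xe]] /andP[eC _]].
by have := disjointFl BC (fintype.subsetP eC _ xe); rewrite (fintype.subsetP eB _ xe).
Qed.

Lemma cl_within_sub S B x : x \in B -> cl (S :&: within B) x \subset B.
Proof.
move=> xB; apply: cl_min => // y z yB; rewrite /adj /= inE mem_within.
by case/and3P.
Qed.

Lemma cl_within S B x : cl S x \subset B -> cl (S :&: within B) x = cl S x.
Proof.
move=> /fintype.subsetP CB; apply/eqP;
  rewrite finset.eqEsubset cl_mono ?finset.subsetIl //=.
apply: cl_min; first exact: cl_refl.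
have sub := fintype.subsetP (cl_mono x (finset.subsetIl S (within B))).
move=> y z yC yz; apply: cl_adj (yC) _.
have yC' := sub _ yC; have zC := cl_adj yC' yz.
by rewrite /adj /= inE mem_within !CB // !andbT; exact: yz.
Qed.

(** Whether the exploration from [x] stops exactly at [B] is decided by the edges meeting [B]; the
    remaining edges are then independent of this event. *)
Lemma cl_touching S B x : (cl (S :&: touching B) x == B) = (cl S x == B).
Proof.
apply/eqP/eqP => e.
  apply/eqP; rewrite finset.eqEsubset -{2}e cl_mono ?finset.subsetIl // andbT.
  apply: cl_min; first by rewrite -e cl_refl.
  move=> y z yB yz; rewrite -e; apply: (@cl_adj _ _ y); first by rewrite e.
  by rewrite /adj /= inE mem_touching yB andbT.
apply/eqP; rewrite finset.eqEsubset -{2}e cl_mono ?finset.subsetIl //=.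
rewrite -{1}e -(cl_within (B := B)) ?e //.
by apply: cl_mono; apply: finset.setIS; exact: within_touching.
Qed.

(** The exit chosen is the last one along the path, so its continuation uses no edge meeting [B]. *)
Lemma cl_exit S B x y : x \in B -> y \notin B -> connect (adj S) x y ->
  exists u v, [/\ u \in B, v \notin B, adj S u v & connect (adj (S :\: touching B)) v y].
Proof.
move=> xB yB /connectP[q xq ylast]; move: yB; rewrite {y}ylast => yB.
suff [[]|//] : (x \notin B /\ connect (adj (S :\: touching B)) x (last x q)) \/
  exists u v, [/\ u \in B, v \notin B, adj S u v &
     connect (adj (S :\: touching B)) v (last x q)].
  by rewrite xB.
elim: q x {xB} xq yB => [|x' q IH] x /=; first by left.
move=> /andP[xx' xq] yB; case: (IH _ xq yB) => [[x'B x'l]|?]; last by right.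
case: (boolP (x \in B)) => xB; first by right; exists x, x'.
left; split=> //; apply: connect_trans x'l; apply: connect1.
by rewrite /adj /= inE mem_touching negb_or xB x'B.
Qed.

Lemma cl_imset S (s : V -> V) x : injective s ->
  cl [set s @: (e : {set V}) | e in S] (s x) = s @: cl S x.
Proof.
move=> si; have adjE y z : adj [set s @: (e : {set V}) | e in S] (s y) (s z) = adj S y z.
  rewrite /adj /= (_ : [set s y; s z] = s @: [set y; z]) ?mem_imset //;
    first exact: imset_inj.
  by rewrite finset.imsetU1 finset.imset_set1.
have [t tK sK] := injF_bij si.
apply/eqP; rewrite finset.eqEsubset; apply/andP; split.
  apply: cl_min; first by rewrite mem_imset ?cl_refl.
  move=> _ z /imsetP[y yC ->]; rewrite -(sK z) adjE mem_imset // => yz.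
  exact: cl_adj yC yz.
apply/fintype.subsetP => _ /imsetP[y yC ->].
have: cl S x \subset s @^-1: cl [set s @: (e : {set V}) | e in S] (s x).
  apply: cl_min; first by rewrite inE cl_refl.
  by move=> u v; rewrite !finset.inE => uC uv; rewrite -!mem_cl in uC *;
    apply: (cl_adj (y := s u)); rewrite ?adjE.
by move=> /fintype.subsetP /(_ _ yC); rewrite inE.
Qed.

End Clusters.

(** * Path splitting and edges between disjoint sets *)

Section Percolation.
Import mathcomp.boot.fintype mathcomp.boot.finset mathcomp.boot.fingraph.
Local Open Scope set_scope.
Import mathcomp.boot.fintype mathcomp.boot.finset mathcomp.boot.fingraph.
Local Open Scope ring_scope.
Variables (R : realType) (V : finType) (p : {set V} -> R).
Hypothesis hp : forall t, 0 <= p t <= 1.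
Implicit Types (S A : {set {set V}}) (C D : {set V}).

(* Condition on the cluster [C] of [x] in [S :&: A]: this event only depends on
   the edges of [A] touching [C], hence is independent of the edge [[set y; z]]
   by which a path leaves [C] and of the continuation of the path off [C]. *)
Lemma Pr_connect_split A x w :
  Pr p (fun S => connect (adj S) x w) <=
  Pr p (fun S => connect (adj (S :&: A)) x w) +
  \sum_y \sum_(z | (z != y) && ([set y; z] \notin A))
    Pr p (fun S => connect (adj (S :&: A)) x y) *
    (p [set y; z] * Pr p (fun S => connect (adj S) z w)).
Proof.
pose f C S : R := (cl (S :&: A) x == C)%:R.
pose g C y z S : R := ([set y; z] \in S)%:R * (connect (adj (S :\: touching C)) z w)%:R.
have fD C : depends (A :&: touching C) (f C).
  move=> S; rewrite /f -[in LHS]cl_touching -finset.setIA; congr (_ == C)%:R.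
  by congr (cl _ x); apply/setP => e; rewrite !inE; case: (e \in A); rewrite ?andbF ?andbT.
have gD C y z : [set y; z] \notin A -> depends (~: (A :&: touching C)) (g C y z).
  move=> yzA S; rewrite /g; congr (_%:R * (connect (adj _) z w)%:R).
    by rewrite in_setI in_setC in_setI (negPf yzA) andbT.
  apply/setP => e; rewrite !inE; case: [disjoint _ & _] => //=.
  by rewrite andbF andbT.
have gE C y z : y \in C -> Ex p (g C y z) <= p [set y;
  z] * Pr p (fun S => connect (adj S) z w).
  move=> yC; rewrite /g (@Ex_indep _ _ _ [set [set y; z]] (~: touching C)).
  - rewrite -/(Pr p _) Pr_mem // ler_wpM2l //; first by case/andP: (hp [set y; z]).
    apply: le_Pr => // S; rewrite -!mem_cl; apply: fintype.subsetP.
    exact/cl_mono/finset.subsetDl.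
  - by rewrite disjoints1 in_setC negbK mem_touching yC.
  - by move=> S; rewrite !inE eqxx andbT.
  - move=> S; congr (connect (adj _) z w)%:R; apply/setP => e; rewrite !inE.
    by case: (~~ _); rewrite ?andbF ?andbT.
pose F C y z S := f C S * g C y z S.
(* Union bound over the cluster [C] and the last edge leaving it; [f] and [g] then decouple because
   they read disjoint sets of edges. *)
apply: (@le_trans _ _ (Ex p (fun S => (connect (adj (S :&: A)) x w)%:R +
  \sum_y \sum_(z | (z != y) && ([set y; z] \notin A))
    \sum_(C : {set V} | (y \in C) && (z \notin C)) F C y z S))).
  apply: le_Ex => // S.
  have F0 C y z : 0 <= F C y z S by rewrite /F /f /g !mulr_ge0 ?ler0n.
  case: (boolP (connect (adj (S :&: A)) x w)) => [_|nxw].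
    rewrite -[leLHS]addr0 lerD ?lern1 ?leq_b1 //.
    by do 3! apply: sumr_ge0 => ? _.
  case: (boolP (connect (adj S) x w)) => [xw|_]; last first.
    by rewrite addr_ge0 //; do 3! apply: sumr_ge0 => ? _.
  rewrite add0r; set C := cl (S :&: A) x.
  have wC : w \notin C by rewrite mem_cl.
  have [u [v [uC vC uv vw]]] := cl_exit (cl_refl _ x) wC xw.
  have vu : v != u by apply: contraNneq vC => ->.
  have uvA : [set u; v] \notin A.
    apply: contraNN vC => uvA; apply: cl_adj uC _.
    by rewrite /adj /= inE uvA andbT.
  rewrite (bigD1 u) //= -[leLHS]addr0 lerD //; last first.
    by do 3! apply: sumr_ge0 => ? _.
  rewrite (bigD1 v) ?vu //= -[leLHS]addr0 lerD //; last first.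
    by do 2! apply: sumr_ge0 => ? _.
  rewrite (bigD1 C) ?uC //= -[leLHS]addr0 lerD //; last first.
    by apply: sumr_ge0 => ? _.
  by rewrite /F /f /g eqxx vw mul1r mulr1; move: uv; rewrite /adj /= => ->.
rewrite ExD lerD // Ex_sum; apply: ler_sum => y _.
rewrite Ex_sum; apply: ler_sum => z /andP[zy yzA]; rewrite Ex_sum.
set q := p [set y; z] * _.
have q0 : 0 <= q by rewrite mulr_ge0 ?Pr_ge0 //; case/andP: (hp [set y; z]).
(* Once the condition that [z] is off [C] is dropped, the events that the cluster is [C], for [C]
   containing [y], partition the event that [x] reaches [y] through [A]. *)
apply: (@le_trans _ _ (\sum_(C : {set V} | y \in C) Ex p (f C) * q)).
  rewrite [leRHS](bigID (fun C : {set V} => z \notin C)) /= -[leLHS]addr0 lerD //.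
    apply: ler_sum => C /andP[yC zC]; rewrite /F (Ex_indep _ _ (fD C) (gD C y z yzA)) //.
      by rewrite ler_wpM2l ?gE // /f; apply: Ex_ge0.
    by rewrite -finset.setI_eq0 finset.setICr.
  by apply: sumr_ge0 => C _; rewrite mulr_ge0 // /f; apply: Ex_ge0.
rewrite -mulr_suml ler_wpM2r // -Ex_sum; apply: le_Ex => // S.
rewrite -mem_cl; case: (boolP (y \in _)) => yC.
  rewrite (bigD1 (cl (S :&: A) x)) //= big1 ?addr0 ?/f ?eqxx //.
  by move=> C /andP[_]; rewrite eq_sym => /negPf; rewrite /f => ->.
rewrite big1 // => C yC'; rewrite /f; case: eqP => // CC.
by rewrite CC yC' in yC.
Qed.

Definition chi A x : R := Ex p (fun S => #|cl (S :&: A) x|%:R).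
Definition chi_ x : R := Ex p (fun S => #|cl S x|%:R).

Lemma ExCl (U : {set {set V}} -> {set {set V}}) x :
  Ex p (fun S => #|cl (U S) x|%:R) = \sum_w Pr p (fun S => connect (adj (U S)) x w).
Proof.
rewrite -Ex_sum; apply: eq_Ex => S; rewrite -sum1_card natr_sum big_mkcond /=.
by apply: eq_bigr => w _; rewrite mem_cl; case: ifP.
Qed.

(** Summing [Pr_connect_split] over the endpoint [w] turns the continuation into a mean cluster
    size, at most [X]; the sum over [z] then costs at most [h], and the sum over [y] rebuilds
    [chi A x]. *)
Lemma chi_split A x (h X : R) : 0 <= X ->
  (forall z, chi_ z <= X) ->
  (forall y, \sum_(z | (z != y) && ([set y; z] \notin A)) p [set y; z] <= h) ->
  chi_ x <= chi A x + chi A x * (h * X).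
Proof.
move=> X0 hX hh; rewrite /chi_ /chi.
rewrite (ExCl id) (ExCl (fun S => S :&: A)).
apply: (le_trans (ler_sum _ (fun w _ => Pr_connect_split A x w))).
rewrite big_split /= lerD2l exchange_big mulr_suml; apply: ler_sum => y _.
rewrite exchange_big /=.
under eq_bigr => z _ do rewrite -mulr_sumr -mulr_sumr -(ExCl id).
rewrite -mulr_sumr ler_wpM2l ?Pr_ge0 //.
apply: le_trans (ler_wpM2r X0 (hh y)); rewrite mulr_suml.
apply: ler_sum => z _; rewrite ler_wpM2l ?hX //.
by case/andP: (hp [set y; z]).
Qed.

Definition between C D : {set {set V}} :=
  [set [set u.1; u.2] | u in finset.setX C D].

Lemma mem_between C D y z : y \in C -> z \in D -> [set y; z] \in between C D.
Proof. by move=> yC zD; apply/imsetP; exists (y, z); rewrite // inE yC zD. Qed.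

Lemma Pr_no_between C D : [disjoint C & D] ->
  Pr p (fun S => [disjoint between C D & S]) =
  \prod_(y in C) \prod_(z in D) (1 - p [set y; z]).
Proof.
move=> CD; rewrite Pr_avoid big_imset /=; last first.
  case=> [y z] [y' z'] /finset.setXP[yC zD] /finset.setXP[yC' zD'] /= e.
  have: y \in [set y'; z'] by rewrite -e !inE eqxx.
  have: z \in [set y'; z'] by rewrite -e !inE eqxx orbT.
  rewrite !inE => /orP[/eqP zy' | /eqP ->].
    by have := disjointFl CD zD; rewrite zy' yC'.
  case/orP => [/eqP -> // | /eqP yz'].
  by have := disjointFl CD zD'; rewrite -yz' yC.
rewrite pair_big_dep /=; apply: eq_big; first by move=> u; rewrite finset.inE.
by case.
Qed.

End Percolation.

(** * The finite hierarchical lattice *)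

Section Hierarchy.
Import mathcomp.boot.fintype mathcomp.boot.finset mathcomp.boot.fingraph.
Local Open Scope set_scope.
Local Open Scope ring_scope.
Variables (F : finZmodType) (M : nat).
Notation V := {ffun 'I_M -> F}.
Implicit Types (x y z a : V) (n : nat) (e : {set V}).

(** Coordinates are counted from one, so distinct points at level [l] are at distance [L ^ l] in the
    lattice; the level is zero exactly on the diagonal. *)
Definition lev x y : nat := \max_(i < M | x i != y i) i.+1.

Lemma lev_leP n x y :
  reflect (forall i : 'I_M, (n <= i)%N -> x i = y i) (lev x y <= n)%N.
Proof.
apply: (iffP (bigmax_leqP _ _ _)) => h i.
  move=> ni; apply/eqP; apply: contraLR ni; rewrite -ltnNge.
  exact: h.
by move=> xy; rewrite ltnNge; apply: contraNN xy => /h ->.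
Qed.

Lemma lev_sym x y : lev x y = lev y x.
Proof. by apply: eq_bigl => i; rewrite eq_sym. Qed.

Lemma levxx x : lev x x = 0%N.
Proof. by apply: big1 => i; rewrite eqxx. Qed.

Lemma lev_eq0 x y : (lev x y == 0%N) = (x == y).
Proof.
rewrite -leqn0; apply/lev_leP/eqP => [h|-> //].
by apply/ffunP => i; exact: h.
Qed.

Lemma lev_leM x y : (lev x y <= M)%N.
Proof. by apply/bigmax_leqP => i _. Qed.

Lemma lev_trans n y x z : (lev x y <= n)%N -> (lev y z <= n)%N -> (lev x z <= n)%N.
Proof. by move=> /lev_leP xy /lev_leP yz; apply/lev_leP => i ni; rewrite xy ?yz. Qed.

Definition tr a x : V := x + a.

Lemma tr_inj a : injective (tr a).
Proof. exact: addIr. Qed.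

Lemma lev_add a x y : lev (tr a x) (tr a y) = lev x y.
Proof. by apply: eq_bigl => i; rewrite !ffunE (inj_eq (addIr _)). Qed.

Definition elev e : nat := \max_(y in e) \max_(z in e) lev y z.

Lemma elev_leP n e :
  reflect {in e &, forall y z, (lev y z <= n)%N} (elev e <= n)%N.
Proof.
apply: (iffP (bigmax_leqP _ _ _)) => h y.
  by move=> z ye ze; have /bigmax_leqP := h _ ye; apply.
by move=> ye; apply/bigmax_leqP => z ze; exact: h.
Qed.

Lemma elev_pair x y : elev [set x; y] = lev x y.
Proof.
apply/eqP; rewrite eqn_leq; apply/andP; split.
  by apply/elev_leP => u v; rewrite !inE => /orP[]/eqP-> /orP[]/eqP->;
    rewrite ?levxx // lev_sym.
have /elev_leP := leqnn (elev [set x; y]).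
by apply; rewrite !inE eqxx ?orbT.
Qed.

Lemma elev_add a e : elev (tr a @: e) = elev e.
Proof.
rewrite /elev big_imset /=; last by move=> ? ? _ _; exact: tr_inj.
apply: eq_bigr => y _; rewrite big_imset /=; last by move=> ? ? _ _; exact: tr_inj.
by apply: eq_bigr => z _; rewrite lev_add.
Qed.

Definition ball n x : {set V} := [set y | (lev x y <= n)%N].

Lemma mem_ball n x y : (y \in ball n x) = (lev x y <= n)%N.
Proof. by rewrite inE. Qed.

Lemma card_ball n x : (n <= M)%N -> #|ball n x| = (#|F| ^ n)%N.
Proof.
move=> nM; pose G (i : 'I_M) : {pred F} := if (i < n)%N then predT else pred1 (x i).
rewrite (@eq_card _ _ (mem (family G))); last first.
  move=> y; rewrite mem_ball; apply/lev_leP/familyP => h i.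
    by rewrite /G; case: ltnP => // ni; rewrite inE h.
  by move=> ni; move: (h i); rewrite /G ltnNge ni inE => /eqP.
rewrite card_family foldrE big_map big_enum /=.
rewrite (eq_bigr (fun i : 'I_M => if (i < n)%N then #|F| else 1%N)); last first.
  by move=> i _; rewrite /G; case: ifP => // _; rewrite card1.
rewrite -big_mkcond /= prod_nat_const; congr (_ ^ _)%N.
rewrite -[RHS]card_ord -(card_imset predT (f := widen_ord nM)); last first.
  by move=> i j /(congr1 val) /= ij; exact: val_inj.
apply: eq_card => i; rewrite unfold_in; apply/idP/imsetP => [ni|[j _ ->]];
  last by have := ltn_ord j.
by exists (Ordinal ni) => //; exact: val_inj.
Qed.

Lemma ball_sub m n x y : (lev x y <= n)%N -> (m <= n)%N -> ball m y \subset ball n x.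
Proof.
move=> xy mn; apply/subsetP => z; rewrite !mem_ball => yz.
exact: lev_trans xy (leq_trans yz mn).
Qed.

Variables (R : realType) (g : nat -> R).
Hypothesis g0 : forall n, 0 <= g n.

(* Subsets which are not pairs are never open; a configuration is then an
   arbitrary set of subsets. *)
Definition open_prob e : R := if #|e| == 2%N then 1 - expR (- g (elev e)) else 0.

Lemma open_prob01 e : 0 <= open_prob e <= 1.
Proof.
rewrite /open_prob; case: ifP => _; last by rewrite lexx ler01.
by rewrite subr_ge0 lerBlDr lerDl expR_ge0 andbT expR_le1 oppr_le0 g0.
Qed.

Lemma open_prob_pair x y : x != y -> open_prob [set x; y] = 1 - expR (- g (lev x y)).
Proof. by move=> xy; rewrite /open_prob cards2 xy elev_pair. Qed.

Lemma open_prob_le x y : x != y -> open_prob [set x; y] <= g (lev x y).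
Proof.
by move=> xy; rewrite open_prob_pair // lerBlDl -lerBlDr; exact: expR_ge1Dx.
Qed.

Lemma open_prob_tr a e : open_prob (tr a @: e) = open_prob e.
Proof. by rewrite /open_prob elev_add card_imset //; exact: tr_inj. Qed.

(** Translations preserve levels, hence opening probabilities, so the law is invariant and all
    vertices are interchangeable. *)
Definition shift a (S : {set {set V}}) : {set {set V}} :=
  [set (tr a @: (e : {set V})) | e in S].

Lemma Ex_shift a f : Ex open_prob (fun S => f (shift a S)) = Ex open_prob f.
Proof.
apply: (Ex_auto (s := fun e : {set V} => tr a @: e)) => [|e].
  exact/imset_inj/tr_inj.
exact: open_prob_tr.
Qed.

Lemma cl_shift a S x : cl (shift a S) (tr a x) = tr a @: cl S x.
Proof. exact/cl_imset/tr_inj. Qed.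

Lemma shiftI a (S A : {set {set V}}) : (forall e, ((tr a @: e) \in A) = (e \in A)) ->
  shift a (S :&: A) = shift a S :&: A.
Proof.
move=> hA; apply/setP => e; rewrite inE; apply/imsetP/andP.
  by case=> f; rewrite inE => /andP[fS fA] ->; rewrite hA fA imset_f.
by case=> /imsetP[f fS ->]; rewrite hA => fA; exists f; rewrite // inE fS fA.
Qed.

Definition Tn n : {set {set V}} := [set e : {set V} | (elev e <= n)%N].

Lemma mem_Tn n x y : ([set x; y] \in Tn n) = (lev x y <= n)%N.
Proof. by rewrite inE elev_pair. Qed.

Lemma chi_transl n x : chi open_prob (Tn n) x = chi open_prob (Tn n) 0.
Proof.
rewrite -[LHS](Ex_shift x); apply: eq_Ex => S.
rewrite -shiftI; last by move=> e; rewrite !inE elev_add.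
by rewrite -{2}[x](add0r x) -[_ + _]/(tr x 0) cl_shift card_imset //; exact: tr_inj.
Qed.

Lemma TnM : Tn M = setT.
Proof. by apply/setP => e; rewrite !inE; apply/elev_leP => y z _ _; exact: lev_leM. Qed.

Lemma chi_TnM x : chi_ open_prob x = chi open_prob (Tn M) x.
Proof. by apply: eq_Ex => S; rewrite TnM setIT. Qed.

Lemma cl_Tn S n x : cl (S :&: Tn n) x \subset ball n x.
Proof.
apply: cl_min; first by rewrite mem_ball levxx.
move=> y z; rewrite !mem_ball /adj /= inE mem_Tn => xy /andP[_ yz].
exact: lev_trans xy yz.
Qed.

Lemma chi_le n x : (n <= M)%N -> chi open_prob (Tn n) x <= (#|F| ^ n)%:R.
Proof.
move=> nM; rewrite -[leRHS](Ex_cst open_prob); apply: le_Ex => [e|S];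
  first exact: open_prob01.
by rewrite ler_nat -(card_ball x nM); exact/subset_leq_card/cl_Tn.
Qed.

Lemma sum_lev n y :
  \sum_(z | (n < lev y z)%N) g (lev y z) <= \sum_(n.+1 <= l < M.+1) (#|F| ^ l)%:R * g l.
Proof.
have -> : \sum_(z | (n < lev y z)%N) g (lev y z) =
  \sum_(l < M.+1 | (n < l)%N) \sum_(z | lev y z == l) g l.
  rewrite (partition_big (fun z => inord (lev y z) : 'I_M.+1) (fun l => n < l)%N) /=.
    apply: eq_bigr => l nl; apply: eq_big => z.
      by rewrite -val_eqE /= inordK ?ltnS ?lev_leM //; case: eqP => [->|];
        rewrite ?nl ?andbF.
    by case/andP => _ /eqP <-; rewrite inordK // ltnS lev_leM.
  by move=> z; rewrite inordK // ltnS lev_leM.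
rewrite big_geq_mkord.
apply: ler_sum => l nl; rewrite sumr_const -[leLHS]mulr_natl ler_wpM2r //.
rewrite ler_nat -(card_ball y (n := l)) -1?ltnS //.
by apply/subset_leq_card/subsetP => z; rewrite mem_ball unfold_in => /eqP ->.
Qed.

End Hierarchy.
Arguments Tn {F M} n.

(** * Upper bounds *)

Lemma geometric_convolution (R : realType) (N : R) (w : nat -> R) K :
  2 <= N -> (forall m, 0 <= w m) ->
  \sum_(n < K) (\sum_(m < n.+1) w m * N ^+ m) / N ^+ n <= 2 * \sum_(m < K) w m.
Proof.
move=> N2 w0; have N0 : 0 < N by rewrite (lt_le_trans _ N2).
pose s n := (\sum_(m < n.+1) w m * N ^+ m) / N ^+ n.
have s0 n : 0 <= s n.
  rewrite divr_ge0 ?exprn_ge0 ?(ltW N0) //; apply: sumr_ge0 => m _.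
  by rewrite mulr_ge0 ?exprn_ge0 ?(ltW N0).
have sS n : 2 * s n.+1 <= 2 * w n.+1 + s n.
  have -> : s n.+1 = w n.+1 + s n / N.
    rewrite /s big_ord_recr /= mulrDl -mulrA divff ?expf_neq0 ?gt_eqF // mulr1 addrC.
    by rewrite exprS invfM mulrA [LHS]addrC -!mulrA [N^-1 * _]mulrC addrC.
  rewrite mulrDr lerD2l mulrA ler_pdivrMr // mulrC.
  exact: ler_wpM2l.
case: K => [|K]; first by rewrite !big_ord0 mulr0.
(* The extra term [s K] closes the induction: the next left side contains [s K.+1] twice, and [sS]
   trades this for [2 * w K.+1 + s K]. *)
suff: \sum_(n < K.+1) s n + s K <= 2 * \sum_(m < K.+1) w m.
  by apply: le_trans; rewrite lerDl.
elim: K => [|K IH].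
  by rewrite !big_ord1 /s big_ord1 expr0 divr1 mulr1 mulr2n mulrDl mul1r.
rewrite big_ord_recr [in leRHS]big_ord_recr /= mulrDr.
have := sS K; lra.
Qed.

Section UpperBound.
Import mathcomp.boot.fintype mathcomp.boot.finset mathcomp.boot.fingraph.
Local Open Scope set_scope.
Local Open Scope ring_scope.
Variables (F : finZmodType) (M : nat) (R : realType) (g : nat -> R).
Hypothesis g0 : forall n, 0 <= g n.
Notation V := {ffun 'I_M -> F}.
Notation pe := (@open_prob F M R g).
Notation V0 := (0%R : {ffun 'I_M -> F}).
Notation N := (#|F|%:R : R).
Notation chiT n := (chi pe (Tn n) V0).
Let pe01 := open_prob01 (F := F) (M := M) g0.

(** [chi_split] is applied with [X] the mean cluster size itself, which is finite and the same at
    every vertex; the last term is then at most half of it and is absorbed on the left. *)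
Lemma chi_double n : (n <= M)%N ->
  chiT n * \sum_(n.+1 <= l < M.+1) (#|F| ^ l)%:R * g l <= 2^-1 ->
  chi_ pe V0 <= 2 * chiT n.
Proof.
move=> nM; set h := \sum_(_ <= _ < _) _ => hh.
have X0 : 0 <= chi_ pe V0 by apply: Ex_ge0.
have := @chi_split R _ pe pe01 (Tn n) 0 h (chi_ pe 0) X0.
have hz z : chi_ pe z <= chi_ pe V0 by rewrite !chi_TnM chi_transl.
have hy (y : V) : \sum_(z | (z != y) && ([set y; z] \notin Tn n)) pe [set y; z] <= h.
  apply: le_trans (sum_lev g0 n y).
  rewrite (eq_bigl (fun z => n < lev y z)%N); last first.
    move=> z; rewrite mem_Tn -ltnNge andbC andb_idr // => nz.
    by rewrite eq_sym -lev_eq0 -lt0n (leq_ltn_trans _ nz).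
  apply: ler_sum => z nz; apply: open_prob_le => //.
  by rewrite -lev_eq0 -lt0n (leq_ltn_trans _ nz).
move=> /(_ hz hy); rewrite mulrA => /le_trans hle.
have := hle _ (lerD (lexx _) (ler_wpM2r X0 hh)); lra.
Qed.

Definition reach m (S : {set {set V}}) :=
  [exists y : V, (lev V0 y == m) && (y \in cl (S :&: Tn m) V0)].
Definition sealed m (S : {set {set V}}) :=
  [disjoint between (ball m V0) (~: ball m 0) & S].

(** If [m] is the highest level met by the cluster in [Tn n], the cluster lies in the [m]-ball, so
    it has at most [N ^+ m] points and its paths use only edges of level at most [m]. *)
Lemma chi_reach n : (n <= M)%N ->
  chiT n <= \sum_(m < n.+1) Pr pe (reach m) * N ^+ m.
Proof.
move=> nM; under eq_bigr do rewrite mulrC -ExZ.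
rewrite -Ex_sum; apply: le_Ex => // S.
have [y yC ymax] := @arg_maxnP _ V0 (mem (cl (S :&: Tn n) V0)) (lev V0) (cl_refl _ _).
have yn : (lev V0 y < n.+1)%N by rewrite ltnS -mem_ball (subsetP (cl_Tn S n V0) y yC).
have Csub : cl (S :&: Tn n) V0 \subset ball (lev V0 y) V0.
  by apply/subsetP => z zC; rewrite mem_ball; exact: ymax.
have reachy : reach (lev V0 y) S.
  apply/existsP; exists y; rewrite eqxx /=; move: yC.
  rewrite -(cl_within Csub); apply: subsetP; apply: cl_mono.
  rewrite -setIA setIS //; apply/subsetP => e;
    rewrite !inE => /andP[_ /andP[/subsetP eB _]].
  apply/elev_leP => u v /eB; rewrite mem_ball lev_sym => u0 /eB; rewrite mem_ball.
  exact: lev_trans u0.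
rewrite (bigD1 (Ordinal yn)) //= reachy mulr1 -[leLHS]addr0 lerD //; last first.
  by apply: sumr_ge0 => i _; rewrite mulr_ge0 ?exprn_ge0.
rewrite -natrX ler_nat -(card_ball V0) ?subset_leq_card //.
by rewrite (leq_trans _ nM).
Qed.

Lemma reach_dep m : depends (Tn m) (reach m).
Proof. by move=> S; rewrite /reach -setIA setIid. Qed.

(** An edge leaving the [m]-ball has level above [m]; hence [sealed m] is independent of
    [reach m]. *)
Lemma sealed_dep m : depends (~: Tn m) (sealed m).
Proof.
move=> S; rewrite /sealed; apply/pred0P/pred0P => h e; have := h e.
  by rewrite /= inE; case: (_ \in between _ _); case: (e \in S).
rewrite /= inE; case: (boolP (e \in between _ _)) => //= /imsetP[[y z]].
rewrite in_setX inE => /andP[] /=; rewrite !inE => y0 z0 ->.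
rewrite elev_pair (_ : ~~ (lev y z <= m)%N) ?andbT //.
by apply: contra z0; exact: lev_trans.
Qed.

(* [reach m] and [sealed m] together force [m] to be the highest level reached by
   the cluster of the origin, so these events are disjoint for distinct [m]. *)
Lemma sum_reach_sealed : \sum_(m < M.+1) Pr pe (reach m) * Pr pe (sealed m) <= 1.
Proof.
rewrite -(Ex1 pe); under eq_bigr => m _.
  rewrite -(Pr_indep _ _ (@reach_dep m) (@sealed_dep m)); last first.
    by rewrite -setI_eq0 setICr.
  over.
rewrite /= -Ex_sum; apply: le_Ex => // S.
pose t : 'I_M.+1 := inord (\max_(y in cl S V0) lev V0 y).
apply: (@le_trans _ _ (\sum_(m < M.+1) (m == t)%:R)); last first.
  by rewrite (bigD1 t) //= eqxx big1 ?addr0 // => m /negPf ->.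
apply: ler_sum => m _; apply: ler_bool => /andP[/existsP[y /andP[/eqP ym yC]] mS].
rewrite -val_eqE /= inordK; last first.
  by rewrite ltnS; apply/bigmax_leqP => z _; exact: lev_leM.
rewrite eqn_leq; apply/andP; split.
  rewrite -ym; apply: leq_bigmax_cond; move: yC; apply/subsetP/cl_mono.
  exact: subsetIl.
apply/bigmax_leqP => z; rewrite -mem_ball; apply/subsetP/cl_min.
  by rewrite mem_ball levxx.
move=> u v uB uv; apply/negPn/negP => vB.
by have := disjointFl mS uv; rewrite mem_between // inE.
Qed.

(** The probability is the exponential of minus the total rate across the boundary, which is at most
    the volume of the ball times the rate above level [m] at one vertex. *)
Lemma Pr_sealed m (c : R) :
  (#|F| ^ m)%:R * \sum_(m.+1 <= l < M.+1) (#|F| ^ l)%:R * g l <= c ->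
  (m <= M)%N -> expR (- c) <= Pr pe (sealed m).
Proof.
move=> hc mM; rewrite /sealed Pr_no_between //; last by rewrite -setI_eq0 setICr.
have -> : \prod_(y in ball m V0) \prod_(z in ~: ball m V0) (1 - pe [set y; z]) =
   expR (- \sum_(y in ball m V0) \sum_(z in ~: ball m V0) g (lev y z)).
  rewrite -sumrN expR_sum; apply: eq_bigr => y yB.
  rewrite -sumrN expR_sum; apply: eq_bigr => z; rewrite inE => zB.
  by rewrite open_prob_pair ?subKr //; apply: contraNneq zB => <-.
rewrite ler_expR lerN2; apply: le_trans hc.
rewrite -(card_ball V0 mM) mulr_natl -sumr_const.
apply: ler_sum => y yB; apply: le_trans (sum_lev g0 m y).
rewrite big_mkcond [leRHS]big_mkcond; apply: ler_sum => z _.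
rewrite inE; case: ifP => zB; last by case: ifP.
rewrite ifT // ltnNge; apply: contraNN zB => yz.
by rewrite mem_ball; apply: lev_trans yz; rewrite -mem_ball.
Qed.

(** Averaging: the ratios of [chiT n] to [N ^+ n] over [n <= K] sum to at most [2 * expR c], so they
    cannot all exceed [2 * expR c / K.+1%:R]. *)
Lemma exists_small_chi K (c : R) : (2 <= #|F|)%N -> (K <= M)%N ->
  (forall m, (m <= M)%N ->
    (#|F| ^ m)%:R * \sum_(m.+1 <= l < M.+1) (#|F| ^ l)%:R * g l <= c) ->
  exists2 n, (n <= K)%N & chiT n * K.+1%:R <= 2 * expR c * N ^+ n.
Proof.
move=> N2 KM hc; apply: contrapT => /forall2NP h.
have N0 : 0 < N by rewrite ltr0n (leq_trans _ N2).
have sw : \sum_(m < K.+1) Pr pe (reach m) <= expR c.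
  have := sum_reach_sealed.
  have wq : \sum_(m < M.+1) Pr pe (reach m) * expR (- c) <=
     \sum_(m < M.+1) Pr pe (reach m) * Pr pe (sealed m).
    apply: ler_sum => m _; apply: ler_wpM2l; first exact: Pr_ge0.
    by apply: Pr_sealed; rewrite ?hc // -ltnS.
  move=> /(le_trans wq); rewrite -mulr_suml expRN ler_pdivrMr ?expR_gt0 // mul1r.
  apply: le_trans; rewrite [leRHS](bigID (fun m : 'I__ => (m < K.+1)%N)) /=.
  rewrite -(big_ord_widen _ (fun m => Pr pe (reach m))) // lerDl.
  by apply: sumr_ge0 => i _; exact: Pr_ge0.
have N2' : 2 <= N by rewrite (ler_nat R 2).
have := geometric_convolution K.+1 N2' (fun m => Pr_ge0 pe01 (reach m)).
apply/negP; rewrite -ltNge.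
apply: (@le_lt_trans _ _ (2 * expR c)); first by rewrite ler_wpM2l.
have -> : 2 * expR c = \sum_(n < K.+1) 2 * expR c / K.+1%:R.
  by rewrite sumr_const card_ord -[RHS]mulr_natr divfK.
apply: ltr_sum; first by apply/hasP; exists ord0; rewrite ?mem_index_enum.
move=> n _; have nK : (n <= K)%N by rewrite -ltnS.
have [//|/negP] := h n; rewrite -ltNge => hn.
rewrite ltr_pdivrMr ?ltr0n // -mulrAC ltr_pdivlMr ?exprn_gt0 //.
apply: lt_le_trans hn _; rewrite ler_wpM2r // chi_reach //.
exact: leq_trans KM.
Qed.

End UpperBound.

(** * Lower bounds *)

Lemma sum_indicator_ge1 (R : realType) (I : finType) (P : pred I) i :
  P i -> 1 <= \sum_i (P i)%:R :> R.
Proof. by move=> Pi; rewrite (bigD1 i) //= Pi lerDl sumr_ge0. Qed.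

Section LowerBound.
Import mathcomp.boot.fintype mathcomp.boot.finset mathcomp.boot.fingraph.
Local Open Scope set_scope.
Local Open Scope ring_scope.
Variables (F : finZmodType) (M : nat) (R : realType) (g : nat -> R).
Hypothesis g0 : forall n, 0 <= g n.
Notation V := {ffun 'I_M -> F}.
Notation pe := (@open_prob F M R g).
Notation V0 := (0%R : {ffun 'I_M -> F}).
Notation N := (#|F|%:R : R).
Let pe01 := open_prob01 (F := F) (M := M) g0.
Implicit Types (S : {set {set V}}) (x y : V) (m : nat) (s t r : R).

Definition big_cluster S (B : {set V}) s :=
  [exists y in B, s <= #|cl (S :&: within B) y|%:R].

Definition prob_small m s := Pr pe (fun S => ~~ big_cluster S (ball m V0) s).

Lemma within_ball_tr m x (e : {set V}) :
  (tr x @: e \in within (ball m x)) = (e \in within (ball m V0)).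
Proof.
rewrite !inE imset_eq0; congr (_ && _); apply/subsetP/subsetP => h y.
  move=> ye; have := h _ (imset_f (tr x) ye); rewrite !mem_ball.
  by rewrite -{1}[x](add0r x) -[_ + _]/(tr x 0) lev_add.
move=> /imsetP[z /h]; rewrite !mem_ball => z0 ->.
by rewrite -{1}[x](add0r x) -[_ + _]/(tr x 0) lev_add.
Qed.

Lemma prob_small_ball m s x :
  Pr pe (fun S => ~~ big_cluster S (ball m x) s) = prob_small m s.
Proof.
rewrite /Pr -(Ex_shift g x) /prob_small /Pr; apply: eq_Ex => S; congr (~~ _)%:R.
have e y : #|cl (shift x S :&: within (ball m x)) (tr x y)| =
    #|cl (S :&: within (ball m V0)) y|.
  rewrite -[RHS](card_imset _ (@tr_inj _ _ x)) -cl_shift; congr #|pred_of_set (cl _ _)|.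
  apply/setP => f; rewrite inE; apply/andP/imsetP.
    by case=> /imsetP[h hS ->]; rewrite within_ball_tr => hw; exists h; rewrite // inE hS.
  by case=> h; rewrite inE => /andP[hS hw] ->; rewrite within_ball_tr hw imset_f.
have b y : (tr x y \in ball m x) = (y \in ball m V0).
  by rewrite !mem_ball -{1}[x](add0r x) -[_ + _]/(tr x 0) lev_add.
apply/existsP/existsP => -[y /andP[yB ys]].
  exists (y - x); rewrite -b -e /tr subrK.
  by rewrite yB.
by exists (tr x y); rewrite b e yB.
Qed.

Lemma big_cluster_dep B s : depends (within B) (fun S => big_cluster S B s).
Proof. by move=> S; rewrite /big_cluster -setIA setIid. Qed.

Lemma within_ball_Tn m x : within (ball m x) \subset Tn m.
Proof.
apply/subsetP => e; rewrite !inE => /andP[/subsetP eB _].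
apply/elev_leP => u v /eB; rewrite mem_ball lev_sym => ux /eB; rewrite mem_ball.
exact: lev_trans ux.
Qed.

(** * Merging the largest clusters of the children of a ball *)

Section Merge.
Variable m : 'I_M.

(** Centres of the [#|F|] balls of level [m] that make up the ball of level [m.+1] around the
    origin. *)
Definition child (i : F) : V := [ffun k => if k == m then i else 0].
Notation B i := (ball m (child i)).

Lemma lev_child i j : i != j -> lev (child i) (child j) = m.+1.
Proof.
move=> ij; apply/eqP; rewrite eqn_leq; apply/andP; split.
  apply/lev_leP => k mk; rewrite !ffunE; case: eqP => // km.
  by rewrite km ltnn in mk.
rewrite ltnNge; apply: contraNN ij => /lev_leP/(_ m (leqnn _)).
by rewrite !ffunE eqxx => ->.
Qed.

Lemma child_ball i : child i \in ball m.+1 V0.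
Proof.
rewrite mem_ball; apply/lev_leP => k mk; rewrite !ffunE; case: eqP => // km.
by rewrite km ltnn in mk.
Qed.

Lemma ball_child_sub i : B i \subset ball m.+1 V0.
Proof. by apply: ball_sub => //; rewrite -mem_ball child_ball. Qed.

Lemma lev_child_ball i j y z : i != j -> y \in B i -> z \in B j -> lev y z = m.+1.
Proof.
move=> ij; rewrite !mem_ball => yi zj; apply/eqP; rewrite eqn_leq; apply/andP; split.
  apply: (@lev_trans _ _ _ (child j)); last exact: leqW.
  apply: (@lev_trans _ _ _ (child i)); last by rewrite lev_child.
  by rewrite lev_sym leqW.
rewrite ltnNge; apply/negP => yz.
have := lev_child ij; apply/eqP; rewrite neq_ltn ltnS; apply/orP; left.
by apply: lev_trans (lev_trans yi yz) _; rewrite lev_sym.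
Qed.

Lemma disjoint_child i j : i != j -> [disjoint B i & B j].
Proof.
move=> ij; apply/pred0P => y /=; apply/negP => /andP[yi yj].
by have := lev_child_ball ij yi yj; rewrite levxx.
Qed.

Definition top_vertex S i : V :=
  [arg max_(y > child i in B i) #|cl (S :&: within (B i)) y|].
Definition top_cluster S i : {set V} := cl (S :&: within (B i)) (top_vertex S i).

Lemma top_vertex_in S i : top_vertex S i \in B i.
Proof. by rewrite /top_vertex; case: arg_maxnP => //; rewrite mem_ball levxx. Qed.

Lemma big_clusterE S i s : big_cluster S (B i) s = (s <= #|top_cluster S i|%:R).
Proof.
apply/existsP/idP => [[y /andP[yB ys]]|h]; last first.
  by exists (top_vertex S i); rewrite top_vertex_in.
apply: le_trans ys _; rewrite ler_nat /top_cluster /top_vertex.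
by case: arg_maxnP => [|z _]; [rewrite mem_ball levxx | apply].
Qed.

Lemma top_cluster_sub S i : top_cluster S i \subset B i.
Proof. exact/cl_within_sub/top_vertex_in. Qed.

Lemma top_cluster_dep i : depends (Tn m) (top_cluster^~ i).
Proof.
apply: (dependsW (within_ball_Tn _ (child i))) => S.
by rewrite /top_cluster /top_vertex -setIA setIid.
Qed.

Definition unlinked S i j := [disjoint between (top_cluster S i) (top_cluster S j) & S].

(** Direct links to the single cluster of [i0] already join everything, and the clusters sit in
    disjoint balls, so their sizes add up. *)
Lemma top_clusters_joined S (I : {set F}) i0 : i0 \in I ->
  {in I &, forall i j, i != j -> ~~ unlinked S i j} ->
  (\sum_(i in I) #|top_cluster S i| <=
     #|cl (S :&: within (ball m.+1 V0)) (top_vertex S i0)|)%N.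
Proof.
move=> i0I hI; set W := S :&: _.
have sub i : S :&: within (B i) \subset W.
  by apply/setIS/within_mono/ball_child_sub.
have Csub i : i \in I -> top_cluster S i \subset cl W (top_vertex S i0).
  move=> iI; have [->|ii0] := eqVneq i i0; first exact: cl_mono.
  have := hI i0 i i0I iI; rewrite eq_sym => /(_ ii0).
  rewrite /unlinked -setI_eq0 => /set0Pn[e]; rewrite inE => /andP[/imsetP[[u v]]].
  rewrite in_setX /= => /andP[uC vC] ->{e} uv.
  have uW := subsetP (cl_mono _ (sub i0)) _ uC.
  have uvW : adj W u v.
    rewrite /adj /= inE uv mem_within.
    rewrite (subsetP (ball_child_sub i0)) ?(subsetP (ball_child_sub i)) //.
      exact: (subsetP (top_cluster_sub S i)).
    exact: (subsetP (top_cluster_sub S i0)).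
  rewrite -(cl_trans (cl_adj uW uvW)) /top_cluster -(cl_trans vC).
  exact: cl_mono.
apply: (@leq_trans #|\bigcup_(i in I) top_cluster S i|); last first.
  by apply/subset_leq_card/bigcupsP.
rewrite -[leqRHS]sum1_card [\bigcup_(i in I) _]big_mkcond partition_disjoint_bigcup /=.
  rewrite big_mkcond /=; apply: leq_sum => i _.
  by case: ifP => _; rewrite sum1_card.
move=> i j ij; case: ifP => _; last by rewrite -setI_eq0 set0I.
case: ifP => _; last by rewrite -setI_eq0 setI0.
apply: disjointWl (top_cluster_sub S i) _.
exact: disjointWr (top_cluster_sub S j) (disjoint_child ij).
Qed.

(* When [t = 0], a child without a cluster of size [r] is simply dropped. *)
Lemma big_cluster_merge S r s t : 0 <= t -> r <= s -> t = 0 \/ r <= t ->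
  (forall i j, i != j -> big_cluster S (B i) s || big_cluster S (B j) s) ->
  (forall i, big_cluster S (B i) t) ->
  (forall i j, i != j -> r <= #|top_cluster S i|%:R -> r <= #|top_cluster S j|%:R ->
     ~~ unlinked S i j) ->
  big_cluster S (ball m.+1 V0) ((N - 1) * s + t).
Proof.
move=> t0 rs tr hs ht hl.
pose I := [set i | r <= #|top_cluster S i|%:R].
have inI i : (i \in I) = (r <= #|top_cluster S i|%:R) by rewrite inE.
have hI : (N - 1) * s + t <= (\sum_(i in I) #|top_cluster S i|)%:R.
  (* At most one child fails to have a cluster of size [s]; [i0] is that child, or an arbitrary one
     if none fails. *)
  have [i0 hi0] : exists i0, forall i, i != i0 -> big_cluster S (B i) s.
    case: (pickP (fun i => ~~ big_cluster S (B i) s)) => [i0 ni0|h].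
      by exists i0 => i /hs; rewrite (negPf ni0) orbF.
    by exists 0 => i _; move: (h i) => /negbFE.
  rewrite natr_sum big_mkcond (bigD1 i0) //= addrC lerD //; last first.
    have := ht i0; rewrite big_clusterE inI; case: ifP => // /negP.
    by case: tr => [-> //|rt h /(le_trans rt)].
  rewrite (_ : N - 1 = #|predC1 i0|%:R); last first.
    by rewrite cardC1 -subn1 natrB // (cardD1 i0).
  rewrite mulr_natl -sumr_const; apply: ler_sum => i ii0.
  have := hi0 i ii0; rewrite big_clusterE inI => hi.
  by rewrite (le_trans rs hi).
have [I0|/set0Pn[i0 i0I]] := eqVneq I set0.
  apply/existsP; exists V0; rewrite mem_ball levxx /=; apply: le_trans hI _.
  by rewrite I0 big_set0.
apply/existsP; exists (top_vertex S i0).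
rewrite (subsetP (ball_child_sub i0)) ?top_vertex_in //=.
apply: le_trans hI _; rewrite ler_nat; apply: top_clusters_joined => // i j.
by rewrite !inI => ri rj ij; exact: hl.
Qed.

(** Freeze the edges of level at most [m]: they determine both clusters, while all edges between the
    two have level [m.+1] and are still random. There are at least [r ^+ 2] of these when both sizes
    reach [r]. *)
Lemma Pr_unlinked r i j : 0 <= r -> i != j ->
  Pr pe (fun S => [&& r <= #|top_cluster S i|%:R, r <= #|top_cluster S j|%:R &
    unlinked S i j]) <= expR (- (g m.+1 * r ^+ 2)).
Proof.
move=> r0 ij; rewrite /Pr (Ex_mix pe (Tn m)) -[leRHS](Ex_cst pe).
apply: le_Ex => // S.
have CS k S' : top_cluster (mix (Tn m) S S') k = top_cluster S k.
  by rewrite top_cluster_dep mixA -top_cluster_dep.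
set X := top_cluster S i; set Y := top_cluster S j.
have XY : [disjoint X & Y].
  apply: disjointWl (top_cluster_sub S i) _.
  exact: disjointWr (top_cluster_sub S j) (disjoint_child ij).
have lXY y z : y \in X -> z \in Y -> lev y z = m.+1.
  by move=> /(subsetP (top_cluster_sub S i)) yX /(subsetP (top_cluster_sub S j));
    exact: lev_child_ball yX.
case/orP: (orbN (r <= #|X|%:R)) => [rX|nrX]; last first.
  apply: le_trans (expR_ge0 _); rewrite -[leRHS](Ex_cst pe 0) le_Ex // => S'.
  by rewrite !CS -/X (negPf nrX).
case/orP: (orbN (r <= #|Y|%:R)) => [rY|nrY]; last first.
  apply: le_trans (expR_ge0 _); rewrite -[leRHS](Ex_cst pe 0) le_Ex // => S'.
  by rewrite !CS -/Y (negPf nrY) andbF.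
apply: (@le_trans _ _ (Pr pe (fun S' => [disjoint between X Y & S']))).
  apply: le_Ex => // S'; apply: ler_bool => /and3P[_ _].
  rewrite /unlinked !CS -/X -/Y => /pred0P h; apply/pred0P => e; have := h e.
  rewrite /= /mix !inE; case: (boolP (e \in between _ _)) => //= /imsetP[[y z]].
  by rewrite in_setX => /andP[yX zY] ->; rewrite elev_pair lXY // ltnn andbF /= => ->.
rewrite Pr_no_between //.
have -> : \prod_(y in X) \prod_(z in Y) (1 - pe [set y; z]) =
    expR (- (g m.+1 * (#|X|%:R * #|Y|%:R))).
  rewrite (eq_bigr (fun=> expR (- g m.+1) ^+ #|Y|)); last first.
    move=> y yX; rewrite -prodr_const; apply: eq_bigr => z zY.
    rewrite open_prob_pair ?lXY //; first by rewrite subKr.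
    by rewrite -lev_eq0 lXY.
  by rewrite prodr_const -exprM -expRM_natr mulrC natrM mulrN mulrA mulrC mulrA mulrAC.
by rewrite ler_expR lerN2 ler_wpM2l // expr2 ler_pM.
Qed.

(** Union bound on the three ways in which [big_cluster_merge] can fail: two children below [s],
    whose independence gives a square; one child below [t]; two clusters of size at least [r] left
    unlinked. *)
Lemma prob_small_merge r s t : 0 <= t -> 0 <= r <= s -> t = 0 \/ r <= t ->
  prob_small m.+1 ((N - 1) * s + t) <=
  N ^+ 2 * prob_small m s ^+ 2 + N * prob_small m t
    + N ^+ 2 * expR (- (g m.+1 * r ^+ 2)).
Proof.
move=> t0 /andP[r0 rs] tr.
pose D S i j := ~~ big_cluster S (B i) s && ~~ big_cluster S (B j) s.
pose U S i j := [&& r <= #|top_cluster S i|%:R, r <= #|top_cluster S j|%:R &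
    unlinked S i j].
apply: (@le_trans _ _ (Ex pe (fun S =>
   \sum_i \sum_(j | i != j) (D S i j)%:R + \sum_i (~~ big_cluster S (B i) t)%:R
   + \sum_i \sum_(j | i != j) (U S i j)%:R))).
  apply: le_Ex => // S; case: (boolP (big_cluster _ _ _)) => [_|nb] /=.
    by rewrite !addr_ge0 //; do ?[apply: sumr_ge0 => ? _].
  have p2 (Q : F -> F -> bool) i j : i != j -> Q i j ->
     1 <= \sum_i \sum_(j | i != j) (Q i j)%:R :> R.
    move=> ij Qij; rewrite (bigD1 i) //= (bigD1 j) //= Qij -addrA lerDl.
    by rewrite addr_ge0 //; do ?[apply: sumr_ge0 => ? _].
  have p1 i : ~~ big_cluster S (B i) t -> 1 <= \sum_i (~~ big_cluster S (B i) t)%:R :> R.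
    exact: (@sum_indicator_ge1 R _ (fun i => ~~ big_cluster S (B i) t)).
  have q2 (Q : F -> F -> bool) : 0 <= \sum_i \sum_(j | i != j) (Q i j)%:R :> R.
    by do ?[apply: sumr_ge0 => ? _].
  have q1 : 0 <= \sum_i (~~ big_cluster S (B i) t)%:R :> R by apply: sumr_ge0.
  have qD := q2 (D S); have qU := q2 (U S).
  apply: contraNT nb; rewrite -ltNge => lt1.
  apply: (@big_cluster_merge S r s t) => //.
  - move=> i j ij; apply: contraTT lt1; rewrite negb_or -leNgt => Dij.
    by have := p2 (D S) i j ij Dij; lra.
  - by move=> i; apply: contraTT lt1 => /p1; rewrite -leNgt; lra.
  - move=> i j ij ri rj; apply: contraTN lt1 => uij; rewrite -leNgt.
    have : 1 <= \sum_i \sum_(j | i != j) (U S i j)%:R :> R.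
      by apply: (p2 (U S) i j ij); rewrite /U ri rj.
    by lra.
have sum2 (f : F -> F -> R) (K : R) : 0 <= K -> (forall i j, i != j -> f i j <= K) ->
    \sum_i \sum_(j | i != j) f i j <= N ^+ 2 * K.
  move=> K0 hf; have -> : N ^+ 2 * K = \sum_(i : F) \sum_(j : F) K.
    by rewrite !sumr_const -mulrnA -[RHS]mulr_natl natrM expr2.
  apply: ler_sum => i _; rewrite big_mkcond; apply: ler_sum => j _.
  by case: ifP => // /hf.
rewrite !ExD; apply: lerD; first apply: lerD.
- rewrite Ex_sum; under eq_bigr do rewrite Ex_sum.
  apply: sum2; first by rewrite sqr_ge0.
  move=> i j ij; rewrite -[leLHS]/(Pr pe (fun S => _ && _)).
  rewrite (Pr_indep pe (within_disjoint (disjoint_child ij))).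
  + have ei := prob_small_ball m s (child i).
    have ej := prob_small_ball m s (child j).
    rewrite expr2 [X in X * _ <= _](_ : _ = prob_small m s); last exact: ei.
    by rewrite [X in _ * X <= _](_ : _ = prob_small m s); last exact: ej.
  + by move=> S; rewrite big_cluster_dep.
  + by move=> S; rewrite big_cluster_dep.
- rewrite Ex_sum mulr_natl -sumr_const; apply: ler_sum => i _.
  by rewrite -/(Pr _ _) prob_small_ball.
rewrite Ex_sum; under eq_bigr do rewrite Ex_sum.
by apply: sum2 => [|i j ij]; [exact: expR_ge0 | exact: Pr_unlinked].
Qed.

End Merge.

Lemma prob_small01 m s : 0 <= prob_small m s <= 1.
Proof. by rewrite Pr_ge0 ?Pr_le1. Qed.

Lemma prob_small_triv m s : s <= 1 -> prob_small m s = 0.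
Proof.
move=> s1; rewrite /prob_small (@eq_Pr _ _ pe _ xpred0) ?/Pr ?Ex_cst // => S.
apply/negbTE/negPn/existsP; exists V0; rewrite mem_ball levxx /=.
apply: le_trans s1 _; rewrite ler1n card_gt0; apply/set0Pn; exists V0.
exact: cl_refl.
Qed.

(** By translation invariance the right side is the mean of the sum of the cluster sizes of all
    vertices, to which a cluster with at least [s] vertices contributes at least [s ^+ 2]. *)
Lemma chi_lower s : 0 <= s ->
  s ^+ 2 * (1 - prob_small M s) <= N ^+ M * chi_ pe V0.
Proof.
move=> s0; have BT : ball M V0 = setT.
  by apply/setP => y; rewrite mem_ball lev_leM inE.
have -> : N ^+ M * chi_ pe V0 = \sum_(x : V) chi_ pe x.
  rewrite (eq_bigr (fun=> chi_ pe V0)); last by move=> x _; rewrite !chi_TnM chi_transl.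
  by rewrite sumr_const card_ffun card_ord -natrX mulr_natl.
rewrite -Ex_sum /prob_small PrC subKr -ExZ; apply: le_Ex => // S.
case/orP: (orbN (big_cluster S (ball M V0) s)) => [bc|/negPf ->]; last first.
  by rewrite mulr0; apply: sumr_ge0.
rewrite bc; have /existsP[y /andP[_ sy]] := bc.
rewrite BT cl_within ?subsetT // in sy; rewrite mulr1.
rewrite (bigID (mem (cl S y))) /= -[leLHS]addr0 lerD //; last exact: sumr_ge0.
rewrite (eq_bigr (fun=> #|cl S y|%:R)); last by move=> x /cl_trans ->.
by rewrite sumr_const -[leRHS]mulr_natl expr2 ler_pM.
Qed.

End LowerBound.

(** * Finite-volume bounds for geometrically decaying rates *)

Section Rates.
Import mathcomp.boot.fintype mathcomp.boot.finset mathcomp.boot.fingraph.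
Local Open Scope set_scope.
Local Open Scope ring_scope.
Variables (F : finZmodType) (M : nat) (R : realType) (b v : R).
Hypotheses (F2 : (2 <= #|F|)%N) (b0 : 0 <= b) (v0 : 0 <= v).
Notation V := {ffun 'I_M -> F}.
(** In the application [b] is beta and [v] is L to the power -(d + alpha), so that [lam] is L to the
    power -(alpha - d): it equals one at alpha = d and is smaller when alpha > d. *)
Definition rate (l : nat) : R := b * v ^+ l.
Notation pe := (@open_prob F M R rate).
Notation V0 := (0%R : {ffun 'I_M -> F}).
Notation N := (#|F|%:R : R).
Notation chiM := (chi_ pe V0).
Notation lam := (N ^+ 2 * v).
Notation small := (@prob_small F M R rate).

Lemma rate_ge0 l : 0 <= rate l.
Proof. by rewrite mulr_ge0 ?exprn_ge0. Qed.
Local Notation g0 := rate_ge0.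

Let N2 : 2 <= N. Proof. by rewrite (ler_nat R 2). Qed.
Let N0 : 0 < N. Proof. by rewrite (lt_le_trans _ N2). Qed.

(** The tail is geometric with ratio [N * v], at most one half, hence at most [b * (N * v) ^+ n];
    the volume factor turns this into a power of [lam]. *)
Lemma rate_tail n : N * v <= 2^-1 ->
  (#|F| ^ n)%:R * \sum_(n.+1 <= l < M.+1) (#|F| ^ l)%:R * rate l <= b * lam ^+ n.
Proof.
move=> Nv; set w := N * v in Nv *; have w0 : 0 <= w by rewrite mulr_ge0 ?(ltW N0).
have -> : \sum_(n.+1 <= l < M.+1) (#|F| ^ l)%:R * rate l =
    b * \sum_(n.+1 <= l < M.+1) w ^+ l.
  by rewrite mulr_sumr; apply: eq_bigr => l _; rewrite /rate /w exprMn natrX mulrCA.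
have hs K : (n <= K)%N -> \sum_(n.+1 <= l < K.+1) w ^+ l <= w ^+ n - w ^+ K.
  elim: K => [|K IH]; first by rewrite leqn0 => /eqP ->; rewrite big_geq // subrr.
  rewrite leq_eqVlt => /predU1P[<-|nK]; first by rewrite big_geq // subrr.
  rewrite big_nat_recr //=; have := IH nK; have := exprn_ge0 K w0.
  rewrite exprS; set x := w ^+ K; set s := \sum_(_ <= _ < _) _ => x0 hs.
  have : w * x <= 2^-1 * x by rewrite ler_wpM2r.
  lra.
have hM : \sum_(n.+1 <= l < M.+1) w ^+ l <= w ^+ n.
  case: (leqP n M) => [/hs|/ltnW nM]; last by rewrite big_geq ?exprn_ge0.
  by move=> /le_trans -> //; rewrite gerDl oppr_le0 exprn_ge0.
rewrite mulrCA ler_wpM2l // natrX.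
rewrite (_ : lam ^+ n = N ^+ n * w ^+ n); last by rewrite /w -exprMn expr2 mulrA.
by rewrite ler_wpM2l // exprn_ge0 // ltW.
Qed.

Lemma chi_upper_subcritical n : N * v <= 2^-1 -> (n <= M)%N ->
  b * lam ^+ n <= 2^-1 -> chiM <= 2 * N ^+ n.
Proof.
move=> Nv nM hn; have hc := chi_le g0 V0 nM.
rewrite natrX in hc.
apply: le_trans (chi_double g0 nM _) _; last by rewrite ler_wpM2l.
apply: le_trans hn; apply: le_trans (rate_tail n Nv).
rewrite natrX ler_wpM2r //; apply: sumr_ge0 => l _.
by rewrite mulr_ge0 ?g0.
Qed.

(** The size of [K] yields some [n <= K] for which [2 * b] times the mean low-level cluster size is
    at most [N ^+ n], while the tail rate at a vertex is at most [b / N ^+ n]; so [chi_double]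
    applies. *)
Lemma chi_upper_critical K : N * v <= 2^-1 -> lam <= 1 -> (K <= M)%N ->
  4 * b * expR b <= K.+1%:R -> chiM <= 2 * N ^+ K.
Proof.
move=> Nv lam1 KM hK.
have lam0 : 0 <= lam by rewrite mulr_ge0 ?exprn_ge0 ?(ltW N0).
have hc m : (m <= M)%N ->
    (#|F| ^ m)%:R * \sum_(m.+1 <= l < M.+1) (#|F| ^ l)%:R * rate l <= b.
  move=> _; apply: le_trans (rate_tail m Nv) _.
  by rewrite -[leRHS]mulr1 ler_wpM2l // exprn_ile1.
have [n nK hn] := exists_small_chi g0 F2 KM hc.
have nM := leq_trans nK KM.
have Nn0 : 0 < N ^+ n by rewrite exprn_gt0.
have c0 : 0 <= chi pe (Tn n) V0 by apply: Ex_ge0 => //; exact: open_prob01 g0.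
apply: le_trans (chi_double g0 nM _) _.
  apply: (@le_trans _ _ (chi pe (Tn n) V0 * (b / N ^+ n))).
    by rewrite ler_wpM2l // ler_pdivlMr // mulrC -natrX hc.
  rewrite mulrA ler_pdivrMr // -(ler_pM2r (ltr0Sn R K)).
  rewrite -mulrA [b * _]mulrC mulrA; apply: le_trans (ler_wpM2r b0 hn) _.
  rewrite [2^-1 * _ * _]mulrAC -[_ * b]mulrA [N ^+ n * b]mulrC mulrA ler_wpM2r ?(ltW Nn0) //.
  lra.
rewrite ler_wpM2l //; apply: le_trans (chi_le g0 V0 nM) _.
by rewrite natrX ler_weXn2l // (le_trans _ N2) // ler1n.
Qed.

Definition small_density m s := small m (s * N ^+ m).

(** Sizes are rescaled by the volume [N ^+ m]; [c] bounds from below the total rate between two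
    whole children of level [m]. *)
Lemma small_density_merge c m r s t : (m < M)%N ->
  c <= rate m.+1 * N ^+ m ^+ 2 ->
  0 <= t -> 0 <= r <= s -> t = 0 \/ r <= t ->
  small_density m.+1 (((N - 1) * s + t) / N) <=
  N ^+ 2 * small_density m s ^+ 2 + N * small_density m t + N ^+ 2 * expR (- (c * r ^+ 2)).
Proof.
move=> mM hc t0 /andP[r0 rs] tr; have Nm : 0 <= N ^+ m by rewrite exprn_ge0 ?(ltW N0).
rewrite /small_density exprS mulrA divfK ?gt_eqF // mulrDl -mulrA.
apply: le_trans (@prob_small_merge F M R rate g0 (Ordinal mM)
  (r * N ^+ m) (s * N ^+ m) (t * N ^+ m) _ _ _) _.
- exact: mulr_ge0.
- by rewrite mulr_ge0 //= ler_wpM2r.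
- by case: tr => [->|rt]; [left; rewrite mul0r | right; rewrite ler_wpM2r].
rewrite lerD2l ler_wpM2l ?exprn_ge0 ?(ltW N0) // ler_expR lerN2 exprMn.
by rewrite [r ^+ 2 * _]mulrC [leRHS]mulrA; apply: ler_wpM2r; rewrite ?exprn_ge0.
Qed.

Lemma small_density01 m s : 0 <= small_density m s <= 1.
Proof. exact/prob_small01/g0. Qed.

Lemma chi_lower_density s : 0 <= s ->
  s ^+ 2 * (1 - small_density M s) * N ^+ M <= chiM.
Proof.
move=> s0; have NM : 0 < N ^+ M by rewrite exprn_gt0.
have := @chi_lower F M R rate g0 (s * N ^+ M); rewrite mulr_ge0 ?(ltW NM) //.
move=> /(_ isT); rewrite -/(small_density M s) exprMn => h.
rewrite -(ler_pM2l NM); apply: le_trans h.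
by rewrite le_eqVlt; apply/orP; left; apply/eqP; ring.
Qed.

Local Notation Q := (2 * N ^+ 2).

(** Density one means that the ball is connected inside itself. Bounding the square linearly, the
    failure probability grows per level by at most the factor [Q] and the term [e]. *)
Lemma chi_lower_connected : lam <= 1 ->
  Q ^+ M * (N ^+ 2 * expR (- (b * v * lam ^+ M))) <= 2^-1 -> N ^+ M / 2 <= chiM.
Proof.
set e := N ^+ 2 * expR _ => lam1 he.
have lam0 : 0 <= lam by rewrite mulr_ge0 ?exprn_ge0 ?(ltW N0).
have e0 : 0 <= e by rewrite mulr_ge0 ?expR_ge0 ?exprn_ge0 ?(ltW N0).
have N24 : 4 <= N ^+ 2 by rewrite (_ : 4 = 2 ^+ 2) ?lerXn2r ?nnegrE ?(ltW N0) // -natrX.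
(* Subtracting [e] absorbs the error added at each step, and gives zero at level zero, where a ball
   is one point. *)
have hm m : (m <= M)%N -> small_density m 1 <= Q ^+ m * e - e.
  elim: m => [_|m IH mM].
    by rewrite /small_density expr0 mulr1 mul1r subrr prob_small_triv ?lexx ?g0.
  have := @small_density_merge (b * v * lam ^+ M) m 1 1 1 mM.
  rewrite mulr1 subrK divff ?gt_eqF // expr1n mulr1 -/e lexx ler01 => h.
  apply: le_trans (h _ _ _ _) _ => //; last 1 first.
  - have /andP[a0 a1] := small_density01 m 1.
    set a := small_density m 1 in a0 a1 IH *.
    have aa : N ^+ 2 * a ^+ 2 <= N ^+ 2 * a.
      by rewrite ler_wpM2l ?exprn_ge0 ?(ltW N0) // expr2 -[leRHS]mulr1 ler_wpM2l.
    have Na : N * a <= N ^+ 2 * a.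
      by rewrite ler_wpM2r // expr2 ler_peMl ?(ltW N0) // (le_trans _ N2) // ler1n.
    have {}IH := IH (ltnW mM).
    have Qa : Q * a <= Q * (Q ^+ m * e - e).
      by apply: ler_wpM2l => //; rewrite mulr_ge0 ?exprn_ge0 ?(ltW N0).
    have Ne : 4 * e <= N ^+ 2 * e by rewrite ler_wpM2r.
    rewrite [Q ^+ m.+1]exprS; move: Qa Ne aa Na; set q := Q ^+ m; set n := N; clearbody q n.
    by move=> Qa Ne aa Na; lra.
  - rewrite /rate [v ^+ m.+1]exprS (_ : b * (v * v ^+ m) * (N ^+ m) ^+ 2 = b * v * lam ^+ m); last first.
      by rewrite exprMn -!exprM mulnC; ring.
    rewrite ler_wpM2l ?mulr_ge0 //; apply: ler_wiXn2l => //; exact: ltnW.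
  - by right.
have := hm M (leqnn _); have := chi_lower_density (@ler01 R).
rewrite expr1n mul1r => h1 h2; apply: le_trans h1.
rewrite mulrC ler_wpM2r ?exprn_ge0 ?(ltW N0) //; lra.
Qed.

(** * Blocks of levels in the critical case *)

Section Blocks.
Variable k : nat.
(** At [lam = 1] the total rate between two sibling balls is [b / N ^+ 2] at every level; [e] bounds
    the chance that two clusters of density at least a quarter in sibling balls stay unlinked. [A]
    is the failure probability maintained from block to block. *)
Let e := N ^+ 2 * expR (- (b / N ^+ 2 * 4^-1 ^+ 2)).
Let A := 2 * Q ^+ k * e.
Hypotheses (lam1 : lam = 1) (he : 16 * Q ^+ (3 * k) * e <= 1).

Let e0 : 0 <= e. Proof. by rewrite mulr_ge0 ?expR_ge0 ?exprn_ge0 ?(ltW N0). Qed.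
Let Q8 : 8 <= Q.
Proof.
rewrite (_ : 8 = 2 * 2 ^+ 2); last by rewrite -natrX -natrM.
by rewrite ler_wpM2l // lerXn2r ?nnegrE ?(ltW N0).
Qed.
Let Q0 : 0 <= Q. Proof. by rewrite (le_trans _ Q8). Qed.
Let Q1 i : 1 <= Q ^+ i. Proof. by rewrite exprn_ege1 // (le_trans _ Q8) // ler1n. Qed.

Let merge m s t : (m < M)%N -> 0 <= t -> 4^-1 <= s -> t = 0 \/ 4^-1 <= t ->
  small_density m.+1 (((N - 1) * s + t) / N) <=
  N ^+ 2 * small_density m s ^+ 2 + N * small_density m t + e.
Proof.
move=> mM t0 hs ht; apply: small_density_merge => //; last by rewrite hs andbT.
have vE : v = N ^- 2.
  by rewrite -[LHS](mulKf (x := N ^+ 2)) ?lam1 ?mulr1 // expf_neq0 // gt_eqF.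
have Nm : N ^+ m != 0 by rewrite expf_neq0 // gt_eqF.
rewrite /rate [v ^+ m.+1]exprS vE exprVn -exprM mulnC exprM.
by rewrite -[leRHS]mulrA divfK ?lexx // !expf_neq0 // gt_eqF.
Qed.

(* Over [k] levels a ball keeps density [s] when all its descendants do, and at
   least [s * (1 - N ^- k)] when one of the [N ^ k] descendants fails: the
   probability of two failures is quadratically small. *)
Lemma block_step m s : (m + k <= M)%N -> 2^-1 <= s ->
  small_density m s <= A -> small_density (m + k) (s * (1 - N ^- k)) <= A.
Proof.
move=> mkM s2 ha; have s4 : 4^-1 <= s by lra.
have NQ : N <= Q.
  by rewrite expr2 mulrA ler_peMl ?(ltW N0) // (le_trans (_ : 1 <= 2)) ?ler1n // ler_peMr // (le_trans _ N2) // ler1n.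
have perfect i : (i <= k)%N -> small_density (m + i) s <= Q ^+ i * (A + e) - e.
  elim: i => [_|i IH ik]; first by rewrite addn0 mul1r addrK.
  have mi : (m + i < M)%N by rewrite (leq_trans _ mkM) // -addnS leq_add2l.
  have := merge mi (le_trans _ s4) s4 (or_intror s4).
  rewrite mulrBl mul1r subrK mulrC mulKf ?gt_eqF // addnS invr_ge0 ler0n => /(_ isT)/le_trans; apply.
  have /andP[a0 a1] := small_density01 (m + i) s.
  set a := small_density _ _ in a0 a1 IH *.
  have aa : N ^+ 2 * a ^+ 2 <= N ^+ 2 * a.
    by rewrite ler_wpM2l ?exprn_ge0 ?(ltW N0) // expr2 -[leRHS]mulr1 ler_wpM2l.
  have Na : N * a <= N ^+ 2 * a.
    by rewrite ler_wpM2r // expr2 ler_peMl ?(ltW N0) // (le_trans _ N2) // ler1n.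
  have {}IH : Q * a <= Q * (Q ^+ i * (A + e) - e) by rewrite ler_wpM2l // IH // ltnW.
  have Qe : 8 * e <= Q * e by rewrite ler_wpM2r.
  rewrite [Q ^+ i.+1]exprS; move: IH Qe aa Na; set q := Q ^+ i; set n := N; clearbody q n.
  by move: (A) (e) e0 => A' e' e0' IH Qe aa Na; lra.
have Nk i : N ^- i <= 1 by rewrite invf_le1 ?exprn_gt0 // exprn_ege1 // (le_trans _ N2) // ler1n.
(* One failed descendant is allowed: it starts the recursion with density zero, and afterwards only
   the child containing it loses density. A second failure enters through the square of the bound in
   [perfect]. *)
have one i : (i <= k)%N -> small_density (m + i) (s * (1 - N ^- i)) <=
    (Q ^+ i * (A + e)) ^+ 2 + Q ^+ i * e - e.
  elim: i => [_|i IH ik].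
    rewrite expr0 invr1 subrr mulr0 /small_density mul0r prob_small_triv ?ler01 ?g0 //.
    by rewrite !mul1r addrK sqr_ge0.
  have mi : (m + i < M)%N by rewrite (leq_trans _ mkM) // -addnS leq_add2l.
  (* The failed descendant is dropped at the first merge; afterwards the defective child has density
     at least [s / 2], hence at least a quarter, and can be linked. *)
  have ht : s * (1 - N ^- i) = 0 \/ 4^-1 <= s * (1 - N ^- i).
    case: i {IH ik mi} => [|i]; first by left; rewrite expr0 invr1 subrr mulr0.
    right; have : N ^- i.+1 <= 2^-1.
      rewrite lef_pV2 ?posrE ?exprn_gt0 // (le_trans N2) // exprS ler_peMr ?(ltW N0) //.
      by rewrite exprn_ege1 // (le_trans _ N2) // ler1n.
    move=> h; have : s * 2^-1 <= s * (1 - N ^- i.+1) by rewrite ler_wpM2l; lra.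
    lra.
  have ht0 : 0 <= s * (1 - N ^- i) by rewrite mulr_ge0 ?subr_ge0 ?Nk //; lra.
  have := merge mi ht0 s4 ht; rewrite addnS.
  have -> : ((N - 1) * s + s * (1 - N ^- i)) / N = s * (1 - N ^- i.+1).
    by rewrite exprS invfM; set x := N ^- i; field; rewrite gt_eqF.
  move=> /le_trans; apply.
  have /andP[a0 a1] := small_density01 (m + i) s.
  have pi := perfect i (ltnW ik).
  set a := small_density _ s in a0 a1 pi *.
  set B := Q ^+ i * (A + e) in pi IH *.
  have aB : a <= B by rewrite (le_trans pi) // gerDl oppr_le0.
  have aa : N ^+ 2 * a ^+ 2 <= N ^+ 2 * B ^+ 2.
    by rewrite ler_wpM2l ?exprn_ge0 ?(ltW N0) // lerXn2r ?nnegrE // (le_trans a0).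
  have {}IH := ler_wpM2l (ltW N0) (IH (ltnW ik)).
  have -> : Q ^+ i.+1 * (A + e) = Q * B by rewrite [Q ^+ i.+1]exprS -[LHS]mulrA.
  have h1 : N * B ^+ 2 <= N ^+ 2 * B ^+ 2.
    by rewrite ler_wpM2r ?sqr_ge0 // expr2 ler_peMl ?(ltW N0) // (le_trans _ N2) // ler1n.
  have h2 : Q * B ^+ 2 <= (Q * B) ^+ 2.
    rewrite [(Q * B) ^+ 2]exprMn ler_wpM2r ?sqr_ge0 // [Q ^+ 2]expr2 ler_peMl //.
    by rewrite (le_trans _ Q8) // ler1n.
  have h3 : N * (Q ^+ i * e) <= Q ^+ i.+1 * e.
    by rewrite [Q ^+ i.+1]exprS mulrA ler_wpM2r // ler_wpM2r // exprn_ge0.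
  have h4 : 2 * e <= N * e by rewrite ler_wpM2r.
  move: IH aa h1 h2 h3 h4; set q := Q ^+ i; set q' := Q ^+ i.+1; set n := N.
  clearbody q q' n; move: (A) (e) (B) e0 => A' e' B' e0'; lra.
apply: le_trans (one k (leqnn k)) _.
have eA : e <= A.
  have qe : 1 * e <= Q ^+ k * e by rewrite ler_wpM2r.
  by rewrite /A; move: qe e0; move: (Q ^+ k) (e) => q e'; lra.
have QA : Q ^+ k * e = A / 2 by rewrite /A; field.
have A0 : 0 <= A by rewrite (le_trans e0).
have hA : 8 * Q ^+ (2 * k) * A <= 1.
  apply: le_trans he; rewrite /A le_eqVlt; apply/orP; left; apply/eqP.
  by rewrite (_ : 3 * k = 2 * k + k)%N ?exprD;
    [ring | rewrite -[in RHS](mul1n k) mulnA muln1 -mulnDl].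
(* By [hA], a rewriting of [he], the quadratic term is at most half of [A]; the linking errors take
   the other half. *)
have : (Q ^+ k * (A + e)) ^+ 2 <= A / 2.
  apply: (@le_trans _ _ ((Q ^+ k * (2 * A)) ^+ 2)).
    rewrite lerXn2r ?nnegrE ?mulr_ge0 ?addr_ge0 ?exprn_ge0 //.
    by rewrite ler_wpM2l ?exprn_ge0 //; lra.
  rewrite (_ : _ ^+ 2 = 8 * Q ^+ (2 * k) * A * (A / 2)).
    by rewrite -[leRHS]mul1r ler_wpM2r // divr_ge0.
  by rewrite mulnC exprM; field.
by rewrite QA; move: e0; move: ((Q ^+ k * (A + e)) ^+ 2) (A) (e) => x A' e'; lra.
Qed.

(** After [J] blocks the density is [(1 - N ^- k) ^+ J], at least one half by Bernoulli's
    inequality. The constant 8 collects the square of this density and a success probability of at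
    least one half. *)
Lemma chi_lower_blocks J : (J * k = M)%N -> (2 * J <= #|F| ^ k)%N -> N ^+ M / 8 <= chiM.
Proof.
move=> JM hJ; set x := N ^- k.
have Nk0 : 0 < N ^+ k by rewrite exprn_gt0.
have x0 : 0 <= x by rewrite invr_ge0 ltW.
have x1 : x <= 1 by rewrite invf_le1 // exprn_ege1 // (le_trans _ N2) // ler1n.
have Jx : J%:R * x <= 2^-1.
  rewrite ler_pdivrMr // -(ler_pM2l (ltr0Sn R 1)) mulrA divff ?gt_eqF // mul1r.
  by rewrite -natrM -natrX ler_nat.
have bern j : 1 - j%:R * x <= (1 - x) ^+ j.
  elim: j => [|j IH]; first by rewrite mul0r subr0 expr0.
  have h : (1 - x) * (1 - j%:R * x) <= (1 - x) * (1 - x) ^+ j by rewrite ler_wpM2l // subr_ge0.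
  rewrite exprS; apply: le_trans h; rewrite -natr1.
  have : 0 <= j%:R * x * x by rewrite !mulr_ge0.
  lra.
have half j : (j <= J)%N -> 2^-1 <= (1 - x) ^+ j.
  move=> jJ; apply: le_trans (bern j).
  have : j%:R * x <= J%:R * x by rewrite ler_wpM2r // ler_nat.
  lra.
have A0 : 0 <= A by rewrite !mulr_ge0 // exprn_ge0.
have step j : (j <= J)%N -> small_density (j * k) ((1 - x) ^+ j) <= A.
  elim: j => [_|j IH jJ].
    by rewrite mul0n expr0 /small_density mul1r expr0 prob_small_triv ?lexx ?g0.
  rewrite mulSn addnC exprSr; apply: block_step => //.
  - by rewrite -JM addnC -mulSn leq_mul2r jJ orbT.
  - by rewrite half // ltnW.
  - by rewrite IH // ltnW.
have A2 : A <= 2^-1.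
  have QQ : Q ^+ k <= Q ^+ (3 * k).
    by rewrite ler_weXn2l ?(le_trans _ Q8) ?ler1n // leq_pmull.
  have : A <= 2 * Q ^+ (3 * k) * e by rewrite ler_wpM2r // ler_wpM2l.
  by move: he; rewrite -!mulrA; lra.
have := step J (leqnn J); rewrite JM => hs.
have hh := half J (leqnn J).
apply: le_trans (chi_lower_density (le_trans _ hh)); last by rewrite invr_ge0.
rewrite mulrC ler_wpM2r ?exprn_ge0 ?(ltW N0) //.
apply: (@le_trans _ _ (2^-1 ^+ 2 * 2^-1)); first by lra.
rewrite ler_pM ?exprn_ge0 ?invr_ge0 //;
  first by rewrite lerXn2r ?nnegrE ?(le_trans _ hh) ?invr_ge0.
lra.
Qed.

End Blocks.
End Rates.

(** * From the infinite lattice to finite balls *)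

Definition digit (d L : nat) : finZmodType := 'rV['Z_L]_d.

Lemma card_digit d L : (1 < L)%N -> #|digit d L| = (L ^ d)%N.
Proof. by move=> L1; rewrite card_mx card_ord Zp_cast // mul1n. Qed.

Section Embedding.
Import mathcomp.boot.fintype mathcomp.boot.finset mathcomp.boot.fingraph.
Variables (d L : nat).
Local Notation F := (digit d L).
Local Notation H := (hlattice d L).

Definition coef (z : H) (k : nat) : F := (z @_ k)%R.

Definition embed M (x : {ffun 'I_M -> F}) : H :=
  \sum_(i < M) << (x i : 'rV['Z_L]_d) *g (i : nat) >>.
Definition restrict M (z : H) : {ffun 'I_M -> F} := [ffun i : 'I_M => coef z i].
Definition supp_lt M (z : H) := forall k, (M <= k)%N -> coef z k = 0.

Lemma coef_embed M (x : {ffun 'I_M -> F}) k :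
  coef (embed x) k = \sum_(i < M | i == k :> nat) x i.
Proof.
rewrite /coef /embed raddf_sum [RHS]big_mkcond /=; apply: eq_bigr => i _.
by rewrite mcoeffU; case: eqP; rewrite ?mulr1n ?mulr0n.
Qed.

Lemma coef_embed_ord M (x : {ffun 'I_M -> F}) (i : 'I_M) : coef (embed x) i = x i.
Proof. by rewrite coef_embed (big_pred1 i). Qed.

Lemma supp_embed M (x : {ffun 'I_M -> F}) : supp_lt M (embed x).
Proof.
move=> k Mk; rewrite coef_embed big_pred0 // => i.
by apply/negbTE; rewrite neq_ltn (leq_trans (ltn_ord i) Mk).
Qed.

Lemma embedK M : cancel (@embed M) (@restrict M).
Proof. by move=> x; apply/ffunP => i; rewrite ffunE coef_embed_ord. Qed.

Lemma embed_inj M : injective (@embed M).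
Proof. exact: can_inj (@embedK M). Qed.

Lemma hlattice_eq (y z : H) : (forall k, coef y k = coef z k) -> y = z.
Proof. by move=> h; apply/malgP => k; exact: h. Qed.

Lemma restrictK M z : supp_lt M z -> embed (restrict M z) = z.
Proof.
move=> hz; apply: hlattice_eq => k; have [kM|Mk] := ltnP k M.
  by rewrite (coef_embed_ord (restrict M z) (Ordinal kM)) ffunE.
by rewrite (supp_embed _ Mk) hz.
Qed.

Lemma embed0 M : embed (0 : {ffun 'I_M -> F}) = 0.
Proof.
rewrite -[RHS](@restrictK M); last by move=> k _; rewrite /coef mcoeff0.
by congr embed; apply/ffunP => i; rewrite !ffunE /coef mcoeff0.
Qed.

Lemma supp_ltW M M' z : (M <= M')%N -> supp_lt M z -> supp_lt M' z.
Proof. by move=> MM hz k Mk; apply: hz; exact: leq_trans MM Mk. Qed.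

Lemma supp_bound z : exists M, supp_lt M z.
Proof.
exists (\max_(k <- msupp z) k).+1 => k hk; apply/eqP; rewrite /coef mcoeff_eq0.
apply: contraTN hk => kz; rewrite -leqNgt; exact: leq_bigmax_seq.
Qed.

Lemma hdist_embed M (x y : {ffun 'I_M -> F}) : x != y ->
  hdist (embed x) (embed y) = (L ^ lev x y)%N.
Proof.
move=> xy; rewrite /hdist (inj_eq (@embed_inj M)) (negPf xy); congr (_ ^ _)%N.
have cB k : (k \in msupp (embed x - embed y)) = (coef (embed x) k != coef (embed y) k).
  by rewrite -mcoeff_neq0 mcoeffB subr_eq0.
apply/eqP; rewrite eqn_leq; apply/andP; split.
  apply/bigmax_leqP_seq => k; rewrite cB => hk _.
  have [kM|Mk] := ltnP k M; last by rewrite !supp_embed ?eqxx in hk.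
  rewrite ltnNge; apply: contraNN hk => /lev_leP /(_ (Ordinal kM) (leqnn _)).
  by rewrite -!coef_embed_ord /= => ->.
apply/lev_leP => i hi; apply/eqP; apply: contraLR hi => xyi.
rewrite -ltnNge; apply: (@leq_bigmax_seq _ _ xpredT (fun k => k.+1)) => //.
by rewrite cB !coef_embed_ord.
Qed.

End Embedding.

Local Open Scope classical_set_scope.
Local Open Scope ring_scope.

(** * Finite-valued random variables *)

Section FiniteValued.
Local Open Scope ereal_scope.
Context (dd : measure_display) (T : measurableType dd) (R : realType).
Variables (mu : {measure set T -> \bar R}) (K : finType) (X : T -> K) (f : K -> R).
Hypothesis mX : forall k, measurable [set w | X w = k].
Hypothesis f0 : forall k, (0 <= f k)%R.

Let decomp : (fun w => (f (X w))%:E) =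
  (fun w => \sum_(k <- index_enum K) (f k)%:E * (\1_[set w | X w = k] w)%:E).
Proof.
apply/funext => w; rewrite (bigD1 (X w)) //= indicE mem_set // mule1 big1 ?adde0 //.
move=> k /eqP kX; rewrite indicE memNset ?mule0 //=.
by move=> Xk; apply: kX; rewrite Xk.
Qed.

Let mterm k : measurable_fun [set: T] (fun w : T => (f k)%:E * (\1_[set w | X w = k] w)%:E).
Proof. by apply: measurable_funeM; apply/measurable_EFinP; exact: measurable_indic. Qed.

Lemma measurable_fin_valued : measurable_fun [set: T] (fun w : T => (f (X w))%:E).
Proof. by rewrite decomp; exact: emeasurable_sum. Qed.

Lemma integral_fin_valued :
  \int[mu]_w (f (X w))%:E = \sum_(k in K) (f k)%:E * mu [set w | X w = k].
Proof.
rewrite decomp ge0_integral_sum //; last first.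
  by move=> k w _; rewrite mule_ge0 // lee_fin.
apply: eq_bigr => k _; rewrite ge0_integralZl_EFin //.
- by rewrite integral_indic // setIT.
- by apply/measurable_EFinP; exact: measurable_indic.
Qed.

End FiniteValued.

(** * Counting measure along increasing sets *)

Section Counting.
Context (R : realType) (T : choiceType).

Lemma counting_image (U : finType) (f : U -> T) (C : {set U}) : injective f ->
  counting [set f x | x in [set` C]] = #|C|%:R%:E :> \bar R.
Proof.
move=> fi; have fin : finite_set [set f x | x in [set` C]].
  exact/finite_image/finite_finset.
rewrite /counting asboolT //; congr (_%:R%:E).
rewrite fset_set_image // card_imfset //= (_ : fset_set _ = [fset x in enum C]%fset).
  by rewrite card_fseq undup_id ?enum_uniq // -cardE.
apply/fsetP => x; rewrite in_fset_set // !inE mem_enum.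
by apply/idP/idP; rewrite inE.
Qed.

(** Any finite part of the union is contained in some [X n]. If the union is finite the sequence
    therefore stabilises; otherwise it eventually contains finite sets of any prescribed size. *)
Lemma cvg_counting (X : nat -> set T) :
  (forall n, finite_set (X n)) -> (forall m n, (m <= n)%N -> X m `<=` X n) ->
  counting (X n) @[n --> \oo] --> (counting (\bigcup_n X n) : \bar R).
Proof.
move=> finX monX; set U := \bigcup_n X n.
have cE n : counting (X n) = (#|` fset_set (X n)|)%:R%:E :> \bar R.
  by rewrite /counting asboolT.
have cap (B : {fset T}) : [set` B] `<=` U -> exists n, [set` B] `<=` X n.
  elim/finSet_rect: B => B IH BU.
  have [->|/fset0Pn[x xB]] := eqVneq B fset0; first by exists 0%N => y.
  have [|n hn] := IH (B `\ x)%fset (fproperD1 xB).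
    by move=> y; rewrite /= in_fsetD1 => /andP[_]; exact: BU.
  have [m _ xm] := BU x xB.
  exists (maxn n m) => y yB; have [->|yx] := eqVneq y x.
    by apply: monX xm; rewrite leq_maxr.
  by apply: (monX _ _ (leq_maxl _ _)); apply: hn; rewrite /= in_fsetD1 yx.
have [finU|infU] := pselect (finite_set U).
  have [n hn] : exists n, U `<=` X n.
    have [|n hn] := cap (fset_set U); first by rewrite fset_setK.
    by exists n; rewrite fset_setK in hn.
  apply: cvg_near_cst; exists n => // m /= nm; congr counting.
  apply/seteqP; split; first by move=> x xm; exists m.
  by apply: subset_trans hn _; exact: monX.
rewrite /counting (asboolF infU); under eq_fun do rewrite -/(counting _) cE.
apply/cvgeryP/cvgryPge => A.
have [B BU hB] := infinite_set_fset (Num.truncn A).+1 infU.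
have [n hn] := cap B BU.
exists n => // m /= nm; have BX : (B `<=` fset_set (X m))%fset.
  apply/fsubsetP => x xB; rewrite in_fset_set //; apply/mem_set.
  by apply: monX nm _ _; exact: hn.
apply: (@le_trans _ _ (#|` B|)%:R); last by rewrite ler_nat fsubset_leq_card.
by apply: le_trans (ltW (truncnS_gt A)) _; rewrite ler_nat.
Qed.

End Counting.

Lemma Pr_superset (R : realType) (T : finType) (p : T -> R) (A : {set T}) :
  Pr p (fun S => A \subset S) = \prod_(t in A) p t.
Proof.
rewrite /Pr (@eq_Ex _ _ p _ (fun S => \prod_t (if t \in S then 1 else (t \notin A)%:R))).
  rewrite Ex_prod [RHS]big_mkcond; apply: eq_bigr => t _.
  by case: (t \in A); rewrite /= ?mulr0 ?mulr1 ?addr0 // addrC subrK.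
move=> S; case: (boolP (A \subset S)) => [/fintype.subsetP AS|].
  rewrite big1 // => t _; case: ifP => // tS; case: (boolP (t \in A)) => // /AS.
  by rewrite tS.
move=> /subsetPn[t tA tS].
by rewrite (bigD1 t) //= (negPf tS) tA mul0r.
Qed.

(* Moebius inversion on the lattice of subsets. *)
Lemma eq_of_superset_sums (R : realType) (T : finType) (f g : {set T} -> R) :
  (forall A : {set T}, \sum_(S : {set T} | A \subset S) f S =
    \sum_(S : {set T} | A \subset S) g S) ->
  f =1 g.
Proof.
move=> h A; have [n] := ubnP #|~: A|%SET; elim: n A => // n IH A hA.
have := h A; rewrite (bigD1 A) //= [RHS](bigD1 A) //=.
rewrite (eq_bigr g); first by move=> /addIr.
move=> S /andP[AS SA]; apply: IH; rewrite ltnS in hA; apply: leq_trans hA.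
apply: proper_card; rewrite finset.properC finset.properEneq.
by rewrite eq_sym SA AS.
Qed.

(** * Law of the open edges in a finite ball *)

Section Trace.
Variables (d L : nat).
Local Notation F := (digit d L).
Local Notation H := (hlattice d L).
Local Notation V M := {ffun 'I_M -> F}.

Definition eimage M (e : {set V M}) : {fset H} := [fset embed x | x in enum e]%fset.

Lemma card_eimage M (e : {set V M}) : #|` eimage e| = #|e|.
Proof.
rewrite /eimage card_imfset /=; last exact: embed_inj.
by rewrite undup_id ?enum_uniq // -cardE.
Qed.

Lemma eimage2 M (x y : V M) : eimage [set x; y]%SET = [fset embed x; embed y]%fset.
Proof.
apply/fsetP => z; rewrite in_fset2; apply/imfsetP/orP.
  by case=> u /=; rewrite mem_enum finset.in_set2 => /orP[] /eqP -> ->; rewrite eqxx;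
    [left|right].
by case=> /eqP ->; [exists x | exists y] => //=; rewrite mem_enum finset.in_set2 eqxx ?orbT.
Qed.

Lemma mem_eimage M (e : {set V M}) x : (embed x \in eimage e) = (x \in e).
Proof. by rewrite mem_imfset /=; [rewrite mem_enum | exact: embed_inj]. Qed.

(** The existential is there because [eimage e] is an edge only when [e] is a pair; other sets never
    belong to the trace, in agreement with [open_prob]. *)
Definition trace M (w : config d L) : {set {set V M}} :=
  [set e : {set V M} | `[< exists2 t : edge d L, w t & val t = eimage e >]]%SET.

Lemma mem_trace M (w : config d L) (e : {set V M}) :
  reflect (exists2 t : edge d L, w t & val t = eimage e) (e \in trace M w).
Proof. by rewrite finset.inE; exact: asboolP. Qed.

Lemma adj_trace M (w : config d L) (x y : V M) :
  adj (trace M w) x y <-> open_adjacent w (embed x) (embed y).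
Proof.
rewrite /adj /=; split=> [/mem_trace[t wt tE]|[t wt tE]].
  by exists t => //; rewrite tE eimage2.
by apply/mem_trace; exists t => //; rewrite eimage2.
Qed.

Section Law.
Variables (R : realType) (alpha beta : R) (P : probability (config d L) R).
Hypothesis hP : percolation_law alpha beta P.

Definition hrate (l : nat) : R := beta * (L ^ l)%:R `^ (- (d%:R + alpha)).
Local Notation pe M := (@open_prob F M R hrate).

Lemma measurable_edge t : measurable (edge_open t : set (config d L)).
Proof. by case: hP => -[h _] _; exact: h. Qed.

Lemma edge_prob M (e : {set V M}) t : val t = eimage e -> P (edge_open t) = (pe M e)%:E.
Proof.
move=> te; have e2 : #|e| == 2%N by rewrite -card_eimage -te; exact: (valP t).
rewrite /open_prob e2; have /cards2P[x [y [xy eE]]] := e2.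
have [_ hpr] := hP; rewrite (hpr t (embed x) (embed y)); last by rewrite te eE eimage2.
by rewrite eE elev_pair hdist_embed.
Qed.

(** If some member of [A] is not a pair, both sides vanish; otherwise the event is a finite
    intersection of independent edge events. *)
Lemma superset_event M (A : {set {set V M}}) :
  P [set w | A \subset trace M w] = (\prod_(e in A) pe M e)%:E.
Proof.
have [/forallP h2|/forallPn /= [e]] := boolP [forall e, (e \in A) ==> (#|e| == 2%N)];
  last first.
  rewrite negb_imply => /andP[eA e2]; rewrite (bigD1 e) //= {1}/open_prob (negPf e2) mul0r.
  rewrite (_ : [set w | _] = set0) ?measure0 //; apply/seteqP; split => // w /=.
  move=> /fintype.subsetP /(_ _ eA) /mem_trace[t _ te].
  by have := valP t; rewrite te card_eimage (negPf e2).
pose h (e : {set V M}) : option (edge d L) := insub (eimage e).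
have hA e : e \in A -> exists2 t, h e = Some t & val t = eimage e.
  move=> eA; rewrite /h; case: insubP => [t _ te|]; first by exists t.
  by rewrite card_eimage (implyP (h2 e) eA).
pose D : {fset edge d L} := [fset t in pmap h (enum A)]%fset.
have inD t : reflect (exists2 e, e \in A & val t = eimage e) (t \in D).
  rewrite in_fset mem_pmap; apply: (iffP mapP) => [[e]|[e eA te]].
    by rewrite mem_enum => eA te; have [t' ht' t'E] := hA e eA; exists e => //; move: te;
      rewrite ht' => -[->].
  exists e; rewrite ?mem_enum //; have [t' -> t'E] := hA e eA.
  by congr Some; apply: val_inj; rewrite te t'E.
rewrite (_ : [set w | _] = \bigcap_(t in [set` D]) edge_open t); last first.
  apply/seteqP; split => w /=.
    move=> /fintype.subsetP AS t /inD[e eA te]; have /mem_trace[t' wt' t'e] := AS e eA.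
    by rewrite /edge_open /= (_ : t = t') //; apply: val_inj; rewrite te t'e.
  move=> hw; apply/fintype.subsetP => e eA; apply/mem_trace.
  by have [t _ te] := hA e eA; exists t => //; apply: hw; apply/inD; exists e.
case: (hP) => -[_ ->] _.
rewrite (perm_big (pmap h (enum A))) /=; last first.
  apply: uniq_perm; rewrite ?fset_uniq //; last by move=> t; rewrite in_fset.
  apply: (pmap_uniq (g := fun t : edge d L => [set x : V M | embed x \in val t]%SET));
    last exact: enum_uniq.
  move=> e; rewrite /h; case: insubP => [t _ te|//] /=.
  by apply/setP => x; rewrite finset.inE te mem_eimage.
rewrite big_pmap -big_enum /= -prodEFin [LHS]big_seq [RHS]big_seq.
apply: eq_bigr => e; rewrite mem_enum => eA; have [t -> te] := hA e eA.
by rewrite /= (edge_prob te).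
Qed.

End Law.
End Trace.

(** * Susceptibility as a limit of finite volumes *)

Section Susceptibility.
Variables (d L : nat).
Local Notation F := (digit d L).
Local Notation H := (hlattice d L).
Local Notation V M := {ffun 'I_M -> F}.
Variables (R : realType) (alpha beta : R) (P : probability (config d L) R).
Hypothesis hP : percolation_law alpha beta P.
Local Notation pe M := (@open_prob F M R (hrate d L alpha beta)).

Lemma measurable_mem_trace M (e : {set V M}) : measurable [set w | e \in trace M w].
Proof.
have [[t te]|nt] := pselect (exists t : edge d L, val t = eimage e).
  rewrite (_ : [set w | _] = edge_open t); first exact: measurable_edge hP t.
  apply/seteqP; split => w /=; last by move=> wt; apply/mem_trace; exists t.
  by move=> /mem_trace[t' wt' te']; rewrite /edge_open /= (_ : t = t') //;
    apply: val_inj; rewrite te te'.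
rewrite (_ : [set w | _] = set0) //; apply/seteqP; split => // w /= /mem_trace[t _ te].
by apply: nt; exists t.
Qed.

Lemma measurable_trace M (S : {set {set V M}}) : measurable [set w | trace M w = S].
Proof.
rewrite (_ : [set w | _] = \bigcap_(e in [set: {set V M}])
   (if e \in S then [set w | e \in trace M w] else ~` [set w | e \in trace M w])).
  apply: fin_bigcap_measurable => [|e _]; first exact: finite_finset.
  by case: ifP => _; last apply: measurableC; exact: measurable_mem_trace.
apply/seteqP; split => w /=; first by move=> wS e _; case: ifP => eS /=; rewrite wS eS.
move=> hw; apply/setP => e; have := hw e I.
by case: ifP => eS //= /negP/negPf.
Qed.

(** The law prescribes the probability that given edges are all open; Moebius inversion recovers
    from these the probability of each exact configuration. *)
Lemma trace_law M (S : {set {set V M}}) :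
  P [set w | trace M w = S] = (wt (pe M) S)%:E.
Proof.
pose q (S : {set {set V M}}) := fine (P [set w | trace M w = S]).
have qE S' : P [set w | trace M w = S'] = (q S')%:E.
  by rewrite fineK // fin_num_measure //; exact: measurable_trace.
rewrite qE; congr (_%:E); apply: eq_of_superset_sums S => A.
transitivity (\prod_(e in A) pe M e); last first.
  rewrite -Pr_superset /Pr /Ex [RHS]big_mkcond /=; apply: eq_bigr => S _.
  by case: ifP; rewrite ?mulr1 ?mulr0.
apply: EFin_inj; rewrite -(superset_event hP).
have mA S' : measurable [set w : config d L | trace M w = S'] := measurable_trace S'.
rewrite -[in RHS](setIT [set w | _]) -integral_indic //; last first.
  rewrite (_ : [set w | _] = \bigcap_(e in [set` A]) [set w | e \in trace M w]).
    apply: fin_bigcap_measurable; first exact: finite_finset.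
    by move=> e _; exact: measurable_mem_trace.
  apply/seteqP; split => w /=; first by move=> /fintype.subsetP AS e /AS.
  by move=> hw; apply/fintype.subsetP => e eA; exact: hw.
transitivity (\int[P]_w ((A \subset trace M w)%:R : R)%:E)%E; last first.
  apply: eq_integral => w _; rewrite indicE; congr (_%:R%:E).
  case: (boolP (A \subset trace M w)) => h; first by rewrite mem_set.
  by rewrite memNset //; exact/negP.
rewrite (integral_fin_valued P (f := fun S : {set {set V M}} => (A \subset S)%:R)) //.
rewrite -sumEFin big_mkcond /=; apply: eq_bigr => S _.
by rewrite qE; case: ifP; rewrite ?mul1e ?mul0e.
Qed.

Definition cluster_size M (w : config d L) : R :=
  #|cl (trace M w) (0 : V M)|%:R.

Lemma measurable_cluster_size M :
  measurable_fun [set: config d L] (fun w => (cluster_size M w)%:E).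
Proof.
exact: (measurable_fin_valued (fun S : {set {set V M}} => #|cl S (0 : V M)|%:R : R)
  (@measurable_trace M)).
Qed.

Lemma integral_cluster_size M :
  (\int[P]_w (cluster_size M w)%:E = (chi_ (pe M) (0 : V M))%:E)%E.
Proof.
rewrite (integral_fin_valued P (f := fun S : {set {set V M}} => #|cl S (0 : V M)|%:R)) //.
  rewrite /chi_ /Ex -sumEFin; apply: eq_bigr => S _.
  by rewrite EFinM muleC; congr (_ * _)%E; exact: trace_law.
exact: measurable_trace.
Qed.

Definition local_cluster M (w : config d L) : set H :=
  [set embed x | x in [set` cl (trace M w) (0 : V M)]].

Lemma local_cluster_sub M w : local_cluster M w `<=` open_cluster w 0.
Proof.
move=> _ /= [x xC <-]; rewrite -(embed0 d L M).
pose B : {set V M} := [set y | `[< clos_refl_trans _ (open_adjacent w)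
  (embed (0 : V M)) (embed y) >]]%SET.
have /fintype.subsetP : cl (trace M w) 0 \subset B.
  apply: cl_min; first by rewrite finset.inE; apply/asboolP; exact: rt_refl.
  move=> y z; rewrite !finset.inE => /asboolP hy /adj_trace yz; apply/asboolP.
  by apply: rt_trans hy _; exact: rt_step.
by move=> /(_ _ xC); rewrite finset.inE => /asboolP.
Qed.

Lemma local_cluster_step M w (y z : H) : local_cluster M w y ->
  supp_lt M z -> open_adjacent w y z -> local_cluster M w z.
Proof.
move=> [x xC <-] hz xz; exists (restrict M z); last exact: restrictK.
by apply: cl_adj xC _; apply/adj_trace; rewrite restrictK.
Qed.

Lemma local_cluster_mono M M' w : (M <= M')%N -> local_cluster M w `<=` local_cluster M' w.
Proof.
move=> MM _ /= [x xC <-].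
pose B : {set V M} := [set y | `[< local_cluster M' w (embed y) >]]%SET.
have /fintype.subsetP : cl (trace M w) 0 \subset B.
  apply: cl_min; rewrite ?finset.inE.
    by apply/asboolP; rewrite embed0 -(embed0 d L M'); exists 0 => //=; exact: cl_refl.
  move=> y z; rewrite !finset.inE => /asboolP hy /adj_trace yz; apply/asboolP.
  by apply: local_cluster_step hy _ yz; apply: supp_ltW MM _; exact: supp_embed.
by move=> /(_ _ xC); rewrite finset.inE => /asboolP.
Qed.

(** An open path visits finitely many vertices, all lying in one ball. *)
Lemma open_clusterE w : open_cluster w 0 = \bigcup_M local_cluster M w.
Proof.
apply/seteqP; split => [y h|y [M _]]; last exact: local_cluster_sub.
have := clos_rt_rtn1 _ _ _ _ h; clear h; elim=> [|{}y z yz _ [M _ hy]].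
  by exists 0%N => //; rewrite -(embed0 d L 0); exists 0 => //=; exact: cl_refl.
have [M' hz] := supp_bound z; exists (maxn M M') => //.
apply: local_cluster_step yz; first exact: local_cluster_mono (leq_maxl _ _) _ hy.
exact: supp_ltW (leq_maxr _ _) hz.
Qed.

Lemma counting_local_cluster M w : counting (local_cluster M w) = (cluster_size M w)%:E.
Proof. by rewrite counting_image //; exact: embed_inj. Qed.

Lemma cluster_size_mono w : {homo (fun M => cluster_size M w) : m n / (m <= n)%N >-> m <= n}.
Proof.
move=> m n mn; have fin k : finite_set (local_cluster k w).
  exact/finite_image/finite_finset.
rewrite -lee_fin -!counting_local_cluster /counting !asboolT // lee_fin ler_nat.
apply: fsubset_leq_card; rewrite -fset_set_sub //.
exact: local_cluster_mono.
Qed.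

(** The local clusters increase to the open cluster, so monotone convergence applies, also when the
    limit is infinite. *)
Lemma cvg_chi_susceptibility :
  (chi_ (pe M) (0 : V M))%:E @[M --> \oo] --> susceptibility P.
Proof.
rewrite /susceptibility; under eq_fun do rewrite -integral_cluster_size.
have -> : (\int[P]_w counting (open_cluster w 0%R) =
    \int[P]_w limn (fun M => (cluster_size M w)%:E))%E.
  apply: eq_integral => w _; apply/esym/cvg_lim => //; rewrite open_clusterE.
  under eq_fun do rewrite -counting_local_cluster.
  apply: cvg_counting; last by move=> m n; exact: local_cluster_mono.
  by move=> k; exact/finite_image/finite_finset.
apply: cvg_monotone_convergence => //.
- exact: measurable_cluster_size.
- by move=> n w _; rewrite lee_fin ler0n.
- by move=> w _ m n mn; rewrite lee_fin; exact: cluster_size_mono.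
Qed.

Lemma chi_mono M M' : (M <= M')%N -> chi_ (pe M) (0 : V M) <= chi_ (pe M') (0 : V M').
Proof.
move=> MM; rewrite -lee_fin -!integral_cluster_size; apply: ge0_le_integral => //;
  try exact: measurable_cluster_size.
- by move=> w _; rewrite lee_fin ler0n.
- by move=> w _; rewrite lee_fin; exact: cluster_size_mono.
Qed.

Lemma susceptibility_ge M : ((chi_ (pe M) (0 : V M))%:E <= susceptibility P)%E.
Proof.
apply: (cvge_to_ge cvg_chi_susceptibility); exists M => // M' /= MM.
by rewrite lee_fin chi_mono.
Qed.

Lemma susceptibility_le (C : R) (K : nat) :
  (forall M, (K <= M)%N -> chi_ (pe M) (0 : V M) <= C) -> (susceptibility P <= C%:E)%E.
Proof.
move=> h; apply: (cvge_to_le cvg_chi_susceptibility); by exists K.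
Qed.

End Susceptibility.

(** * Asymptotics *)

Section Bounds.
Variables (R : realType) (d L : nat) (alpha : R).
Hypotheses (hd : (1 <= d)%N) (hL : (2 <= L)%N) (halpha : d%:R <= alpha).
Local Notation F := (digit d L).
Local Notation lnL := (ln (L%:R : R)).
Local Notation N := (#|F|%:R : R).
Local Notation chiM beta M :=
  (chi_ (@open_prob F M R (hrate d L alpha beta)) (0 : {ffun 'I_M -> F})).

Let v : R := L%:R `^ (- (d%:R + alpha)).

Lemma L_expR : L%:R = expR lnL :> R.
Proof. by rewrite lnK // posrE ltr0n (leq_trans _ hL). Qed.

Lemma lnL_gt0 : 0 < lnL.
Proof. by rewrite ln_gt0 // ltr1n. Qed.

Lemma card_expR : N = expR (d%:R * lnL).
Proof. by rewrite card_digit // natrX expRM_natl -L_expR. Qed.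

Lemma powR_L x : L%:R `^ x = expR (x * lnL) :> R.
Proof. by rewrite /powR gt_eqF // ltr0n (leq_trans _ hL). Qed.

Lemma hrateE beta : hrate d L alpha beta = rate beta v.
Proof.
apply/funext => l; rewrite /hrate /rate /v powR_L; congr (_ * _).
rewrite natrX [in LHS]L_expR -expRM_natl /powR gt_eqF ?expR_gt0 // expRK.
by rewrite mulrCA expRM_natl.
Qed.

Lemma card_ge2 : (2 <= #|F|)%N.
Proof. by rewrite card_digit // (leq_trans hL) // -{1}(expn1 L) leq_exp2l. Qed.

Lemma v_ge0 : 0 <= v. Proof. exact: powR_ge0. Qed.

Lemma N_v : N * v <= 2^-1.
Proof.
rewrite card_expR /v powR_L -expRD.
have d1 : 1 <= alpha by rewrite (le_trans _ halpha) // ler1n.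
have : expR (d%:R * lnL - (d%:R + alpha) * lnL) <= expR (- lnL).
  by rewrite ler_expR; have := lnL_gt0; nra.
rewrite mulNr => /le_trans; apply; rewrite expRN -L_expR.
by rewrite lef_pV2 ?posrE ?ltr0n ?(leq_trans _ hL) // ler_nat.
Qed.

Lemma N2_v : N ^+ 2 * v = expR (- ((alpha - d%:R) * lnL)).
Proof. by rewrite card_expR /v powR_L -expRM_natl -expRD; congr expR; ring. Qed.

Lemma lam_le1 : N ^+ 2 * v <= 1.
Proof. by rewrite N2_v expR_le1 oppr_le0 mulr_ge0 ?subr_ge0 // ltW // lnL_gt0. Qed.

Variable S : R -> \bar R.
Hypothesis S_ge : forall beta M, 0 <= beta -> ((chiM beta M)%:E <= S beta)%E.
Hypothesis S_le : forall beta (C : R) K, 0 <= beta ->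
  (forall M, (K <= M)%N -> chiM beta M <= C) -> (S beta <= C%:E)%E.

Lemma critical_upper : exists C : R, 1 <= C /\
  forall beta, 1 <= beta -> (S beta <= (expR (expR (C * beta)))%:E)%E.
Proof.
pose l := d%:R * lnL; have l0 : 0 <= l by rewrite mulr_ge0 // ltW // lnL_gt0.
(* The part [2 * b] of the exponent pays for [b * expR b <= expR (b + b)], and the part
   [(1 + 4 * l) * b] for the constants in [1 + K%:R * l]. *)
exists (3 + 4 * l); split; first by lra.
move=> b b1; have b0 : 0 <= b by lra.
pose K := Num.truncn (4 * b * expR b).
have K0 : 0 <= 4 * b * expR b by rewrite !mulr_ge0 ?expR_ge0.
have /andP[K1 K2] := truncn_itv K0.
have := @S_le b (2 * N ^+ K) K b0; move=> /(_ _)/le_trans; apply.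
  move=> M KM; rewrite hrateE; apply: chi_upper_critical => //.
  - exact: card_ge2.
  - exact: v_ge0.
  - exact: N_v.
  - exact: lam_le1.
  - exact: ltW.
rewrite lee_fin card_expR -expRM_natl.
apply: (@le_trans _ _ (expR (1 + K%:R * l))).
  rewrite expRD ler_wpM2r ?expR_ge0 //; have := expR_ge1Dx (1 : R); lra.
rewrite ler_expR.
have h1 : b <= expR b by have := expR_ge1Dx b; lra.
have h2 : K%:R * l <= 4 * (expR b * expR b) * l.
  rewrite ler_wpM2r //; apply: le_trans K1 _; rewrite -mulrA ler_wpM2l //.
  by rewrite ler_wpM2r ?expR_ge0.
have h3 : 1 <= expR b * expR b.
  by rewrite -expRD -expR0 ler_expR; lra.
have h4 : 1 + 4 * l <= expR ((1 + 4 * l) * b).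
  apply: (@le_trans _ _ (expR (1 + 4 * l))); first by have := expR_ge1Dx (1 + 4 * l); lra.
  by rewrite ler_expR ler_peMr //; lra.
have -> : (3 + 4 * l) * b = (b + b) + (1 + 4 * l) * b by ring.
rewrite expRD [expR (b + b)]expRD.
have h5 := ler_wpM2l (le_trans ler01 h3) h4.
by apply: le_trans h5; lra.
Qed.

Lemma critical_lower : alpha = d%:R -> exists c b0 : R, [/\ 0 < c, c <= 1 &
  forall beta, b0 <= beta -> ((expR (expR (c * beta)))%:E <= S beta)%E].
Proof.
move=> ad; have lam1 : N ^+ 2 * v = 1 by rewrite N2_v ad subrr mul0r oppr0 expR0.
have N2 : 2 <= N by rewrite (ler_nat R 2) card_ge2.
pose Q := 2 * N ^+ 2; have Q8 : 8 <= Q by rewrite /Q; nra.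
pose w := 16 * N ^+ 2; have w1 : 1 <= w by rewrite /w; nra.
have QE : Q = 2 * N ^+ 2 by []; have wE : w = 16 * N ^+ 2 by [].
clearbody Q w; have wQ1 : 1 <= 6 * w * Q by nra.
(* For [k <= c1 * b] this gives [3 * k * Q <= b / (2 * w)], so that [Q ^+ (3 * k)] uses at most half
   of the exponent [b / w]. *)
pose c1 := (6 * w * Q)^-1; have c1E : c1 = (6 * w * Q)^-1 by []; clearbody c1.
have wQ0 : 0 < 6 * w * Q by rewrite (lt_le_trans _ wQ1).
have c10 : 0 < c1 by rewrite c1E invr_gt0.
have c11 : c1 <= 1 by rewrite c1E invf_le1.
(* The term [2 * w * w] leaves the other half of [b / w] to the constant [w]; the term [16 / c1]
   forces [k > 15], needed when exponents are compared at the end. *)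
exists (c1 / 4), (2 * w * w + 16 / c1); split; [by lra | by lra |] => b hb.
have ww : 0 <= 2 * w * w by nra.
have cb : 16 <= c1 * b.
  have : 16 / c1 <= b by lra.
  by rewrite ler_pdivrMr // mulrC.
have b0 : 0 <= b.
  have : 0 <= 16 / c1 by rewrite divr_ge0 // ltW.
  lra.
pose k := Num.truncn (c1 * b).
have /andP[k1 k2] : k%:R <= c1 * b < k.+1%:R by apply: truncn_itv; lra.
have k15 : (15 < k)%N by rewrite -ltnS -(ltr_nat R) (le_lt_trans cb).
have k15R : 15 <= k%:R :> R by rewrite (ler_nat R 15) ltnW.
(* As [#|F|] is at least 2, this many blocks keep the density above one half; the height [M] is then
   exponential in [k], hence in [b], and [N ^+ M] doubly exponential. *)
pose J := (#|F| ^ k.-1)%N; pose M := (J * k)%N.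
have k0 : (0 < k)%N by rewrite (leq_trans _ k15).
have w0 : 0 < w by rewrite (lt_le_trans _ w1).
have small : 16 * Q ^+ (3 * k) * (N ^+ 2 * expR (- (b / N ^+ 2 * 4^-1 ^+ 2))) <= 1.
  have N0 : N != 0 by rewrite gt_eqF // (lt_le_trans _ N2).
  have -> : b / N ^+ 2 * 4^-1 ^+ 2 = b / w by rewrite wE; field.
  have -> : 16 * Q ^+ (3 * k) * (N ^+ 2 * expR (- (b / w))) =
      w * Q ^+ (3 * k) * expR (- (b / w)).
    by rewrite {2}wE; move: (Q ^+ _) (expR _) => q e; ring.
  have hw : w <= expR w by have := expR_ge1Dx w; lra.
  have hQ : Q ^+ (3 * k) <= expR ((3 * k)%:R * Q).
    rewrite expRM_natl lerXn2r ?nnegrE ?expR_ge0 //; first by rewrite (le_trans _ Q8).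
    by have := expR_ge1Dx Q; lra.
  apply: (@le_trans _ _ (expR w * expR ((3 * k)%:R * Q) * expR (- (b / w)))).
    rewrite ler_wpM2r ?expR_ge0 // ler_pM ?(ltW w0) //.
    by rewrite exprn_ge0 // (le_trans _ Q8).
  rewrite -!expRD expR_le1.
  have hk : k%:R * (6 * w * Q) <= b.
    by rewrite -ler_pdivlMr // mulrC -c1E.
  have : (w + (3 * k)%:R * Q) * w <= b.
    rewrite natrM mulrDl; have : 2 * (w * w) <= b.
      have : 0 <= 16 / c1 by rewrite divr_ge0 // ltW.
      lra.
    lra.
  by rewrite -ler_pdivlMr //; lra.
rewrite QE in small; have F2 := card_ge2.
have hJ : (2 * J <= #|F| ^ k)%N.
  by rewrite /J -{2}(prednK k0) expnS leq_mul2r F2 orbT.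
apply: (le_trans _ (@S_ge b M b0)); rewrite hrateE lee_fin.
apply: (le_trans _ (chi_lower_blocks F2 b0 v_ge0 lam1 small (erefl _) hJ)).
pose X := (2 ^ k.-1)%N.
have XM : (X <= M)%N.
  rewrite /M /J (leq_trans (_ : _ <= #|F| ^ k.-1)%N) //;
    first by rewrite leq_exp2r // -subn1 subn_gt0 (leq_trans _ k15).
  by rewrite leq_pmulr.
have e2 : expR 2^-1 <= 2 :> R.
  have := expR_ge1Dx (- 2^-1 : R); rewrite expRN => h.
  have : 2^-1 <= (expR 2^-1)^-1 :> R by lra.
  by rewrite lef_pV2 ?posrE ?expR_gt0.
have e2n n : expR (n%:R / 2) <= 2 ^+ n :> R.
  by rewrite expRM_natl lerXn2r ?nnegrE ?expR_ge0.
have e8 : expR (- 3) <= 8^-1 :> R.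
  rewrite expRN lef_pV2 ?posrE ?expR_gt0 //.
  have -> : 3 = 3%:R * 1 :> R by rewrite mulr1.
  have -> : 8 = 2 ^+ 3 :> R by ring.
  by rewrite expRM_natl lerXn2r ?nnegrE ?expR_ge0 //; have := expR_ge1Dx (1 : R); lra.
have XN : 2 ^+ X <= N ^+ M.
  apply: (@le_trans _ _ (2 ^+ M)); first by rewrite ler_weXn2l // ler1n.
  by rewrite lerXn2r ?nnegrE // (le_trans _ N2).
have X8 : 8 <= X%:R :> R.
  rewrite (ler_nat R 8) (_ : 8 = 2 ^ 3)%N // /X leq_exp2l //.
  by rewrite -ltnS prednK // (leq_trans _ k15).
have XE : X = (2 ^ k.-1)%N by []; clearbody X.
apply: (@le_trans _ _ (expR (X%:R / 2) * expR (- 3))); last first.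
  by rewrite ler_pM ?expR_ge0 // (le_trans (e2n X)).
clear small; clearbody M J k.
rewrite -expRD ler_expR.
apply: (@le_trans _ _ (expR (k.-1%:R / 2) * expR (- 3))); last first.
  apply: (@le_trans _ _ (X%:R * 8^-1)); last by lra.
  by rewrite ler_pM ?expR_ge0 // (le_trans (e2n k.-1)) // XE natrX.
rewrite -expRD ler_expR.
(* As [c1 * b < k + 1], it suffices that [(k + 1) / 4 <= (k - 1) / 2 - 3], which is [15 <= k]. *)
have : k%:R = k.-1%:R + 1 :> R by rewrite natr1 prednK.
by move: k2; rewrite -natr1; lra.
Qed.

Lemma subcritical_upper : d%:R < alpha -> exists C : R, forall beta, 1 <= beta ->
  (S beta <= (expR (C + d%:R / (alpha - d%:R) * ln beta))%:E)%E.
Proof.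
move=> da; pose a := alpha - d%:R; have a0 : 0 < a by rewrite subr_gt0.
pose l := lnL; have l0 : 0 < l := lnL_gt0.
pose C := 1 + d%:R * l + d%:R / a.
exists C => b b1; have b0 : 0 < b by lra.
have lb0 : 0 <= ln b by rewrite ln_ge0.
(* The real height at which [b * lam ^+ n] would equal [expR (- 1)]; rounding it up costs only a
   constant factor. *)
pose x := (1 + ln b) / (a * l).
have al0 : 0 < a * l by rewrite mulr_gt0.
have x0 : 0 <= x by rewrite divr_ge0 ?(ltW al0) //; lra.
pose n := (Num.truncn x).+1.
have /andP[n1 n2] := truncn_itv x0; rewrite -/n in n2.
have e1 : 2 <= expR 1 :> R by have := expR_ge1Dx (1 : R); lra.
have := @S_le b (2 * N ^+ n) n (ltW b0); move=> /(_ _)/le_trans; apply.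
  move=> M nM; rewrite hrateE; apply: chi_upper_subcritical => //.
  - exact: card_ge2.
  - exact: ltW.
  - exact: v_ge0.
  - exact: N_v.
  rewrite N2_v -expRM_natl -{1}(lnK (x := b)) // -expRD.
  apply: (@le_trans _ _ (expR (- 1))); last first.
    by rewrite expRN lef_pV2 ?posrE ?expR_gt0.
  rewrite ler_expR -/a -/l.
  have : (1 + ln b) <= n%:R * (a * l) by rewrite -ler_pdivrMr // ltW.
  lra.
rewrite lee_fin card_expR -expRM_natl.
apply: (@le_trans _ _ (expR (1 + n%:R * (d%:R * l)))).
  by rewrite expRD ler_wpM2r ?expR_ge0.
rewrite ler_expR -/a.
have h : n%:R * (d%:R * l) <= (x + 1) * (d%:R * l).
  by rewrite ler_wpM2r ?mulr_ge0 ?(ltW l0) // /n -natr1 lerD2r.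
apply: (@le_trans _ _ (1 + (x + 1) * (d%:R * l))); first by rewrite lerD2l.
rewrite le_eqVlt; apply/orP; left; apply/eqP; rewrite /x /C; field.
by rewrite !gt_eqF.
Qed.

Lemma subcritical_lower (eps : R) : d%:R < alpha -> 0 < eps < 1 ->
  exists C b1 : R, forall beta, b1 <= beta ->
  ((expR ((1 - eps) * (d%:R / (alpha - d%:R)) * ln beta - C))%:E <= S beta)%E.
Proof.
move=> da /andP[ep0 ep1]; pose a := alpha - d%:R; have a0 : 0 < a by rewrite subr_gt0.
pose l := lnL; have l0 : 0 < l := lnL_gt0.
have al0 : 0 < a * l by rewrite mulr_gt0.
have N2 : 2 <= N by rewrite (ler_nat R 2) card_ge2.
have v0 : 0 < v by rewrite powR_gt0 // ltr0n (leq_trans _ hL).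
pose Q := 2 * N ^+ 2; have Q8 : 8 <= Q by rewrite /Q; nra.
have QE : Q = 2 * N ^+ 2 by []; clearbody Q.
(* [K1 * t] will bound [M%:R * Q], and [K2] the logarithm of [N ^+ 2] plus one, which leaves a
   failure probability below one half; [t0] is such that [K1 * t + K2 <= v * expR (eps * t)] from
   there on. *)
pose K1 := Q / (a * l); pose K2 := N ^+ 2 + 1.
have K1E : K1 = Q / (a * l) by []; have K2E : K2 = N ^+ 2 + 1 by [].
have K10 : 0 <= K1 by rewrite divr_ge0 ?(ltW al0) // (le_trans _ Q8).
have K20 : 0 <= K2 by rewrite /K2; nra.
clearbody K1 K2; pose t0 := 1 + 4 * (K1 + K2) / (v * eps ^+ 2).
have ve0 : 0 < v * eps ^+ 2 by rewrite mulr_gt0 // exprn_gt0.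
have t01 : 1 <= t0.
  by rewrite /t0 lerDl divr_ge0 ?(ltW ve0) // mulr_ge0 // addr_ge0.
have t0E : t0 = 1 + 4 * (K1 + K2) / (v * eps ^+ 2) by []; clearbody t0.
exists (d%:R * l + 1), (expR t0) => b hb.
have b0 : 0 < b by rewrite (lt_le_trans _ hb) ?expR_gt0.
pose t := ln b; have bt : b = expR t by rewrite lnK.
have tE : ln b = t by []; clearbody t.
have tt0 : t0 <= t by rewrite -ler_expR -bt.
have t1 : 1 <= t by lra.
(* A fraction [1 - eps] of the height at which [b * lam ^+ M] would be one: the rate between
   siblings is then still at least [v * expR (eps * t)]. *)
pose x := (1 - eps) * t / (a * l); have xE : x = (1 - eps) * t / (a * l) by [].
clearbody x; have x0 : 0 <= x by rewrite xE divr_ge0 ?(ltW al0) // mulr_ge0 //; lra.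
pose M := Num.truncn x.
have /andP[M1 M2] := truncn_itv x0; rewrite -/M in M1 M2.
have key : K1 * t + K2 <= v * expR (eps * t).
  have h1 : 1 + eps * t / 2 <= expR (eps * t / 2) by exact: expR_ge1Dx.
  have et : 0 <= eps * t by rewrite mulr_ge0 //; lra.
  have h2 : (eps * t / 2) ^+ 2 <= expR (eps * t).
    have -> : expR (eps * t) = expR (eps * t / 2) ^+ 2.
      by rewrite -expRM_natl; congr expR; field.
    by rewrite lerXn2r ?nnegrE ?expR_ge0 //; lra.
  apply: (le_trans _ (ler_wpM2l (ltW v0) h2)).
  have h3 : 4 * (K1 + K2) <= t * (v * eps ^+ 2).
    by rewrite -ler_pdivrMr //; rewrite t0E in tt0; lra.
  have h4 : 4 * (K1 + K2) * t <= t * (v * eps ^+ 2) * t by rewrite ler_wpM2r //; lra.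
  have h5 : K2 <= K2 * t by rewrite ler_peMr.
  have -> : v * (eps * t / 2) ^+ 2 = t * (v * eps ^+ 2) * t / 4 by field.
  lra.
have F2 := card_ge2.
apply: (le_trans _ (@S_ge b M (ltW b0))); rewrite hrateE lee_fin.
apply: (le_trans _ (chi_lower_connected F2 (ltW b0) v_ge0 lam_le1 _)); last first.
  rewrite -QE N2_v -expRM_natl -/a -/l.
  have lM : v * expR (eps * t) <= b * v * expR (M%:R * - (a * l)).
    rewrite [b * v]mulrC -mulrA ler_wpM2l ?(ltW v0) // bt -expRD ler_expR.
    have : M%:R * (a * l) <= (1 - eps) * t by rewrite -ler_pdivlMr // -xE.
    lra.
  have hM : M%:R * Q <= K1 * t.
    apply: (@le_trans _ _ (x * Q)); first by rewrite ler_wpM2r // (le_trans _ Q8).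
    rewrite xE K1E [Q / _ * t]mulrAC -[_ / _ * Q]mulrAC ler_wpM2r ?invr_ge0 ?(ltW al0) //.
    by rewrite [Q * t]mulrC ler_wpM2r ?(le_trans _ Q8) //; nra.
  have hQ : Q ^+ M <= expR (M%:R * Q).
    rewrite expRM_natl lerXn2r ?nnegrE ?expR_ge0 //; first by rewrite (le_trans _ Q8).
    by have := expR_ge1Dx Q; lra.
  have hN : N ^+ 2 <= expR (N ^+ 2) by have := expR_ge1Dx (N ^+ 2); lra.
  apply: (@le_trans _ _ (expR (M%:R * Q) * (expR (N ^+ 2) *
      expR (- (b * v * expR (M%:R * - (a * l))))))).
    rewrite ler_pM ?exprn_ge0 ?(le_trans _ Q8) ?mulr_ge0 ?expR_ge0 ?sqr_ge0 //.
    by rewrite ler_wpM2r ?expR_ge0.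
  rewrite -!expRD; apply: (@le_trans _ _ (expR (- 1))); last first.
    rewrite expRN lef_pV2 ?posrE ?expR_gt0 //.
    by have := expR_ge1Dx (1 : R); lra.
  by rewrite ler_expR; rewrite K2E in key; lra.
rewrite card_expR -expRM_natl.
apply: (@le_trans _ _ (expR (M%:R * (d%:R * l)) * expR (- 1))); last first.
  rewrite ler_wpM2l ?expR_ge0 // expRN lef_pV2 ?posrE ?expR_gt0 //.
  by have := expR_ge1Dx (1 : R); lra.
rewrite -expRD ler_expR -/a.
have : x * (d%:R * l) <= (M%:R + 1) * (d%:R * l).
  by rewrite ler_wpM2r ?mulr_ge0 ?(ltW l0) // natr1 ltW.
have -> : x * (d%:R * l) = (1 - eps) * (d%:R / a) * t.
  by rewrite xE; field; rewrite !gt_eqF.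
rewrite tE; lra.
Qed.

End Bounds.

Lemma cvg_log_ratio (R : realType) (S : R -> \bar R) (D : R) : 0 <= D ->
  (exists C : R, forall beta, 1 <= beta -> (S beta <= (expR (C + D * ln beta))%:E)%E) ->
  (forall eps : R, 0 < eps < 1 -> exists C b1 : R, forall beta, b1 <= beta ->
     ((expR ((1 - eps) * D * ln beta - C))%:E <= S beta)%E) ->
  (lne (S beta) * ((ln beta)^-1)%:E)%E @[beta --> +oo] --> D%:E.
Proof.
move=> D0 [C hC] hl.
have cmp beta (x y : R) : ((expR x)%:E <= S beta)%E -> (S beta <= (expR y)%:E)%E ->
    exists z : R, [/\ lne (S beta) = z%:E, x <= z & z <= y].
  case: (S beta) => [s| |] // xs sy.
  rewrite !lee_fin in xs sy; have s0 : 0 < s := lt_le_trans (expR_gt0 x) xs.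
  exists (ln s); rewrite lne_EFin //; split => //.
    by rewrite -ler_expR lnK.
  by rewrite -ler_expR lnK.
have half : 0 < (2^-1 : R) < 1 by apply/andP; split; lra.
have [C2 [b2 hC2]] := hl 2^-1 half.
(* The bounds already show that [S beta] is eventually positive and finite, so its logarithm is
   real. *)
apply: cvg_EFin.
  exists (Num.max 1 b2); split=> [|b /=]; first exact: num_real.
  rewrite gt_max => /andP[b1 bb].
  have [z [-> _ _]] := cmp _ _ _ (hC2 b (ltW bb)) (hC b (ltW b1)).
  by rewrite -EFinM.
apply/cvgrPdist_le => eps eps0.
(* Half of the tolerance pays for the loss in the exponent; [D + 1] keeps the divisor positive when
   [D = 0]. *)
pose e' := Num.min 2^-1 (eps / (2 * (D + 1))).
have e'0 : 0 < e' < 1.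
  rewrite /e' lt_min gt_min; apply/andP; split; last by apply/orP; left; lra.
  by rewrite divr_gt0 //= ?invr_gt0 ?mulr_gt0 //; lra.
have e'D : e' * D <= eps / 2.
  apply: (@le_trans _ _ (eps / (2 * (D + 1)) * D)).
    by rewrite ler_wpM2r // /e' ge_min lexx orbT.
  rewrite mulrAC ler_pdivrMr; last by lra.
  by nra.
have [C1 [b1 hC1]] := hl e' e'0; clearbody e'.
(* Beyond [t0] the additive constants, divided by [ln b], take at most the other half of [eps]. *)
pose t0 := 1 + 2 * (`|C| + `|C1|) / eps.
have t01 : 1 <= t0 by rewrite lerDl divr_ge0 ?(ltW eps0) // mulr_ge0 // addr_ge0.
exists (Num.max (Num.max 1 b1) (expR t0)); split=> [|b /=]; first exact: num_real.
rewrite !gt_max => /andP[/andP[bge1 bb1] bt0].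
have [z [E h1 h2]] := cmp _ _ _ (hC1 b (ltW bb1)) (hC b (ltW bge1)).
rewrite E -EFinM /=.
have tb : t0 <= ln b by rewrite -ler_expR lnK ?ltW // posrE; lra.
set t := ln b in tb h1 h2 *; clearbody t.
have t1 : 0 < t by lra.
have ht : 2 * (`|C| + `|C1|) <= eps * t.
  by rewrite -ler_pdivrMl // mulrC; rewrite /t0 in tb; lra.
have hCa := ler_norm C; have hC1a := ler_norm C1.
have n0 := normr_ge0 C; have n1 := normr_ge0 C1.
clearbody t0.
have e't : e' * D * t <= eps / 2 * t by rewrite ler_wpM2r // ltW.
rewrite ler_norml; apply/andP; split.
  rewrite lerBrDr -lerBrDl opprK ler_pdivrMr //; nra.
rewrite lerBlDr -lerBlDl ler_pdivlMr //; nra.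
Qed.

Theorem theorem1p1 (R : realType) (d L : nat) (alpha : R)
    (hd : (1 <= d)%N) (hL : (2 <= L)%N) (halpha : d%:R <= alpha)
    (P : R -> probability (config d L) R)
    (hP : forall beta : R, 0 <= beta -> percolation_law alpha beta (P beta)) :
  (alpha = d%:R ->
     exists c C beta0 : R,
       [/\ 0 < c, c <= C &
         forall beta : R, beta0 <= beta ->
           ((expR (expR (c * beta)))%:E <= susceptibility (P beta))%E /\
           (susceptibility (P beta) <= (expR (expR (C * beta)))%:E)%E]) /\
  (d%:R < alpha ->
     (lne (susceptibility (P beta)) * ((ln beta)^-1)%:E)%E @[beta --> +oo]
       --> (d%:R / (alpha - d%:R))%:E).
Proof.
pose S beta := susceptibility (P beta).
have S_ge beta M (b0 : 0 <= beta) := susceptibility_ge (hP beta b0) M.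
have S_le beta C K (b0 : 0 <= beta) := susceptibility_le (hP beta b0) (C := C) (K := K).
split=> [ad|da].
  have [C [C1 hC]] := critical_upper hd hL halpha S_le.
  have [c [b0 [c0 c1 hc]]] := critical_lower hd hL S_ge ad.
  exists c, C, (Num.max 1 b0); split => //; first exact: le_trans c1 C1.
  by move=> beta; rewrite ge_max => /andP[b1 bb]; split; [exact: hc | exact: hC].
apply: (@cvg_log_ratio R S).
- by rewrite divr_ge0 // subr_ge0.
- exact: (subcritical_upper hd hL halpha S_le da).
- by move=> eps he; exact: (subcritical_lower hd hL halpha S_ge da he).
Qed.
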